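(* Let $\sigma$ be a sigmoidal function and let $\varphi$ be a convex $\varphi$-function such that $u\mapsto u^{-\beta}\varphi(u)$, $u>0$, is increasing, for some $\beta>1$. Assume $M^\varphi_{0,2}(\phi_\sigma)<+\infty$. Let $L\ge1$ be the constant of the equivalence between $\varphi$ and a $\varphi$-function $\psi$ with $\psi^{1/\beta}$ convex, i.e. $\psi(t/L)\le\varphi(t)\le\psi(Lt)$ for all $t\ge0$. Then there are constants $\xi_1^{\sigma,\varphi}>0$ and $\xi_2^{\sigma,\varphi}>0$ (independent of $f$, $\lambda$, $n$) such that, for every $f\in\mathcal W^{1,\varphi}(I)$, there exists $0<\lambda<1$ with $$I^\varphi\big[\lambda(K_nf-f)\big]\le\xi_1^{\sigma,\varphi}\cdot\frac{\lambda}{n}+\xi_2^{\sigma,\varphi}\cdot I^\varphi\left[\frac{4\lambda L^2}{n}\,(f')^2\right]$$ for every sufficiently large $n\in\mathbb N$.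
   Context: Let $I=[a,b]\subset\mathbb R$ with $a<b$. Sigmoidal functions. A measurable $\sigma:\mathbb R\to\mathbb R$ is sigmoidal if $\lim_{x\to-\infty}\sigma(x)=0$ and $\lim_{x\to+\infty}\sigma(x)=1$. Here every sigmoidal function is assumed non-decreasing, with $\sigma(1)<1$, and to satisfy: (S1) $\sigma(x)-1/2$ is an odd function; (S2) $\sigma\in C^2(\mathbb R)$ is concave for $x\ge 0$; (S3) $\sigma(x)=\mathcal O(|x|^{-\alpha-1})$ as $x\to-\infty$ for some $\alpha>0$. The density function is $\phi_\sigma(x):=\frac12[\sigma(x+1)-\sigma(x-1)]$, $x\in\mathbb R$. Operators. For $f:I\to\mathbb R$ locally integrable and $n\in\mathbb N$ with $\lceil na\rceil\le\lfloor nb\rfloor-1$ (this is assumed of every $n$ considered), $$(K_nf)(x)=\frac{\sum_{k=\lceil na\rceil}^{\lfloor nb\rfloor-1}\left[n\int_{k/n}^{(k+1)/n}f(u)\,du\right]\phi_\sigma(nx-k)}{\sum_{k=\lceil na\rceil}^{\lfloor nb\rfloor-1}\phi_\sigma(nx-k)},\quad x\in I.$$ Orlicz spaces. A $\varphi$-function is a continuous non-decreasing $\varphi:[0,\infty)\to[0,\infty)$ with $\varphi(0)=0$, $\varphi(u)>0$ for $u>0$, $\lim_{u\to\infty}\varphi(u)=+\infty$. For measurable $f$ on $I$, $I^\varphi[f]:=\int_I\varphi(|f(x)|)\,dx$; $L^\varphi(I)$ is the set of measurable $f$ on $I$ with $I^\varphi[\lambda f]<+\infty$ for some $\lambda>0$.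 The Sobolev-Orlicz space is $W^{1,\varphi}(I):=\{f\in AC(I): f'\in L^\varphi(I)\}$, where $AC(I)$ is the space of absolutely continuous functions $I\to\mathbb R$, and $\mathcal W^{1,\varphi}(I):=\{f\in W^{1,\varphi}(I): (f')^2\in L^\varphi(I)\}$. Moments: for $\nu,\mu\ge0$, $M^\varphi_{\nu,\mu}(\phi_\sigma):=\sup_{u\in\mathbb R}\sum_{k\in\mathbb Z}\phi_\sigma(u-k)\,|u-k|^\nu\,\varphi(|u-k|^\mu)$; so $M^\varphi_{0,2}(\phi_\sigma)=\sup_{u\in\mathbb R}\sum_{k\in\mathbb Z}\phi_\sigma(u-k)\,\varphi(|u-k|^2)$. It is known (Hästö) that if $u\mapsto u^{-\beta}\varphi(u)$ is increasing on $(0,\infty)$ for some $\beta>1$, then there are a $\varphi$-function $\psi$ and $L\ge1$ with $\psi(t/L)\le\varphi(t)\le\psi(Lt)$ for $t\ge0$ and $\psi^{1/\beta}$ convex, where $\psi^{1/\beta}(x):=(\psi(x))^{1/\beta}$. *)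

(* Defs.v *)
From HB Require Import structures.
From mathcomp Require Import all_boot all_order all_algebra.
From mathcomp Require Import all_classical all_reals all_analysis.

Set Implicit Arguments.
Unset Strict Implicit.
Unset Printing Implicit Defensive.

Import Order.TTheory GRing.Theory Num.Theory.
Import numFieldNormedType.Exports.

Local Open Scope classical_set_scope.
Local Open Scope ring_scope.

(** Functions on [[0, +oo[] and on [[a, b]] are represented by total functions
    [R -> R]; only their values on these sets matter (up to a null set for
    derivatives at the endpoints). *)

(** Lets Landau notations be used with the filter [-oo]. *)
Canonical ninfty_filter_on (R : realType) : filter_on R :=
  @FilterType R (ninfty_nbhs R) _.

Section sigmoidal.
Context {R : realType}.

Record sigmoidal (sigma : R -> R) : Prop := {
  sigmoidal_measurable : measurable_fun setT sigma ;
  sigmoidal_cvgNy : sigma x @[x --> -oo] --> (0 : R) ;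
  sigmoidal_cvgy : sigma x @[x --> +oo] --> (1 : R) ;
  sigmoidal_ndecr : {homo sigma : x y / x <= y} ;
  sigmoidal_lt1 : sigma 1 < 1 ;
  sigmoidal_odd : forall x, sigma (- x) - 2^-1 = - (sigma x - 2^-1) ;
  sigmoidal_derivable : forall x, derivable sigma x 1 ;
  sigmoidal_derivable2 : forall x, derivable (derive1 sigma) x 1 ;
  sigmoidal_C2 : continuous (derive1n 2 sigma) ;
  sigmoidal_concave :
    convex_function (`[0, +oo[%classic : set R) (fun x : R => - sigma x) ;
  sigmoidal_bigO : exists2 alpha : R, 0 < alpha &
    sigma =O_ (-oo_ R) (fun x : R => `|x| `^ (- alpha - 1)) }.

Definition density (sigma : R -> R) (x : R) : R :=
  2^-1 * (sigma (x + 1) - sigma (x - 1)).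

End sigmoidal.

Section operators.
Context {R : realType}.
Variables (a b : R).

(** The standing assumption on [n]; it forces [0 < n]. *)
Definition admissible (n : nat) : Prop :=
  Num.ceil (n%:R * a) <= Num.floor (n%:R * b) - 1.

(** The index set is finite, so the [\sum_(_ \in _)] below are finite sums. *)
Definition Kindex (n : nat) : set int :=
  [set k | Num.ceil (n%:R * a) <= k <= Num.floor (n%:R * b) - 1].

Definition Kop (sigma f : R -> R) (n : nat) (x : R) : R :=
  (\sum_(k \in Kindex n)
     (n%:R * \int[lebesgue_measure]_(u in `[k%:~R / n%:R, (k + 1)%:~R / n%:R]) f u)
       * density sigma (n%:R * x - k%:~R))
  / \sum_(k \in Kindex n) density sigma (n%:R * x - k%:~R).

End operators.

Section orlicz.
Context {R : realType}.

Record phi_function (phi : R -> R) : Prop := {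
  phi_continuous : {within `[0, +oo[, continuous phi} ;
  phi_ndecr : forall u v, 0 <= u -> u <= v -> phi u <= phi v ;
  phi_0 : phi 0 = 0 ;
  phi_gt0 : forall u, 0 < u -> 0 < phi u ;
  phi_cvgy : phi u @[u --> +oo] --> +oo }.

Definition convex_nneg (phi : R -> R) : Prop :=
  convex_function (`[0, +oo[%classic : set R) phi.

Variables (a b : R) (phi : R -> R).

Definition modular (f : R -> R) : \bar R :=
  (\int[lebesgue_measure]_(x in `[a, b]) (phi `|f x|)%:E)%E.

Definition Lorlicz : set (R -> R) :=
  [set f | measurable_fun `[a, b] f /\
    exists2 lambda : R, 0 < lambda &
      (modular (fun x => lambda * f x)%R < +oo)%E].

Definition abs_cont : set (R -> R) :=
  [set f | forall eps : R, 0 < eps -> exists2 delta : R, 0 < delta &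
    forall (N : nat) (s t : 'I_N -> R),
      (forall i, a <= s i /\ s i < t i /\ t i <= b) ->
      trivIset setT (fun i => `]s i, t i[%classic) ->
      \sum_(i < N) (t i - s i) < delta ->
      \sum_(i < N) `|f (t i) - f (s i)| < eps].

(** [derive1 f] is [f'] wherever [f] is differentiable, which is almost
    everywhere for [f] in [abs_cont]; on the remaining null set it is a constant
    default value, except possibly at [a] and [b]. *)
Definition sobolev_orlicz : set (R -> R) :=
  [set f | abs_cont f /\ Lorlicz (derive1 f)].

Definition sobolev_orlicz2 : set (R -> R) :=
  [set f | sobolev_orlicz f /\ Lorlicz (fun x => derive1 f x ^+ 2)].

(** Only meant for [chi >= 0]; [0 `^ 0 = 1] for [powR]. *)
Definition moment (nu mu : R) (chi : R -> R) : \bar R :=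
  ereal_sup (range (fun u : R =>
    \esum_(k in [set: int])
      (chi (u - k%:~R) * `|u - k%:~R| `^ nu * phi (`|u - k%:~R| `^ mu))%:E)).

End orlicz.

(* Main.v *)
Require Import Defs.
From HB Require Import structures.
From mathcomp Require Import all_boot all_order all_algebra.
From mathcomp Require Import all_classical all_reals all_analysis.
From mathcomp Require Import measurable_realfun.
From mathcomp Require Import ring lra.

Set Implicit Arguments.
Unset Strict Implicit.
Unset Printing Implicit Defensive.

Import Order.TTheory GRing.Theory Num.Theory.
Import numFieldNormedType.Exports.

Local Open Scope classical_set_scope.
Local Open Scope ring_scope.

(** Fix [x] in [[a, b]].  The number [Kop f n x - f x] is a convex combination,
    with weights [w_k] proportional to [density (n x - k)], of the deviations of
    [f x] from the means of [f] over the cells [[k/n, (k+1)/n]].  Let [J_k] be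
    the smallest interval that contains both [x] and the [k]-th cell, [h_k] its
    length and [v_k = |n x - k|], so that [1/n <= h_k <= (v_k + 1)/n].  An
    absolutely continuous [f] satisfies [|f u - f x| <= \int |f'|] over [J_k]
    for every [u] in the cell, and then Jensen's inequality turns [phi] of the
    deviation into means over [J_k] of [phi (lambda h_k |f'|)].

    The arithmetic-geometric step [h |f'| <= max (n h^2) (f'^2 / n)] separates
    the two terms of the theorem:
    - [phi (lambda n h_k^2)] is of size [(lambda/n) (phi (v_k^2) + phi 1)] by
      convexity as soon as [4 lambda <= n], and its weighted sum over [k] is
      bounded by the moment [M_{0,2}];
    - the means over [J_k] of [G = phi (4 lambda L^2 f'^2 / n)], which bounds
      [phi (lambda f'^2 / n)], have a weighted sum of at most a constant times
      the convolution of [G] with the kernel [n / (1 + n^2 y^2)].  Indeed a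
      point [t] of [J_k] satisfies [n |x - t| <= v_k + 1], hence
      [n <= (3 + 2 v_k^2) n / (1 + n^2 (x - t)^2)], and the second moments
      [\sum w_k v_k^2] are controlled by [M_{0,2}] too because a convex [phi]
      grows at least linearly.
    This is [Kop_pointwise].  Integrating in [x], Tonelli's theorem and the mass
    [pi] of the kernel ([integral_cauchy_convolution_le]) give the modular
    inequality.  The two constants depend only on [a], [b], the density and
    [phi]; the value [lambda = 1/2] suits every [f].

    The calculus fact behind this, [|f y - f x| <= \int |f'|] for absolutely
    continuous [f], includes the almost everywhere differentiability of [f].
    It is obtained by writing [f] as a difference of two nondecreasing
    absolutely continuous functions by means of the total variation.  The
    Stieltjes measure of such a function does not charge Lebesgue null sets, so
    it has a Radon-Nikodym density ([nondecreasing_abs_cont_density]), and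
    Lebesgue's differentiation theorem identifies the difference of the two
    densities with [f'] ([abs_cont_ftc]). *)

(** * Total variation of absolutely continuous functions *)

Section absolute_continuity.
Context {R : realType}.
Implicit Types (a b : R) (f : R -> R).

(** Arbitrary finite index types and degenerate intervals are allowed here: the
    first lets families of families be indexed by a sigma type, the second lets
    intervals be truncated to [[a, b]]. *)
Lemma abs_cont_finType a b f : abs_cont a b f ->
  forall eps : R, 0 < eps -> exists2 delta : R, 0 < delta &
    forall (I : finType) (s t : I -> R),
      (forall i, [/\ a <= s i, s i <= t i & t i <= b]) ->
      trivIset setT (fun i => `]s i, t i[%classic) ->
      \sum_i (t i - s i) < delta -> \sum_i `|f (t i) - f (s i)| < eps.
Proof.
move=> acf eps eps0; have [d d0 H] := acf eps eps0.
exists d => // I s t st tI sd.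
pose A := [pred i | s i < t i].
have sumA (F : I -> R) : (forall i, s i = t i -> F i = 0) ->
    \sum_i F i = \sum_(i < #|A|) F (enum_val i).
  move=> F0; rewrite -(big_enum_val F) [LHS](bigID (mem A)) /=.
  rewrite [X in _ + X]big1 ?addr0// => i.
  rewrite inE -leNgt => ti; apply: F0; apply/eqP.
  by rewrite eq_le ti; have [_ -> _] := st i.
rewrite sumA; last by move=> i ->; rewrite subrr normr0.
apply: (H _ (s \o enum_val) (t \o enum_val)).
- move=> i; have [? _ ?] := st (enum_val i); do ! split => //=.
  exact: (enum_valP i).
- move=> i j _ _ ij; apply: enum_val_inj; exact: tI ij.
- by rewrite -(sumA (fun i => t i - s i))// => i ->; rewrite subrr.
Qed.

Lemma itv_partition_pieces_disjoint (c d : R) l (i j : nat) :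
  itv_partition c d l -> (i < size l)%N -> (j < size l)%N ->
  `]nth d (c :: l) i, nth d (c :: l) i.+1[%classic `&`
  `]nth d (c :: l) j, nth d (c :: l) j.+1[%classic !=set0 -> i = j.
Proof.
move=> [pl _] il jl [y []] /=; rewrite !in_itv/= => /andP[iy yi] /andP[jy yj].
have mono p q : (p <= q)%N -> (q <= size l)%N ->
    nth d (c :: l) p <= nth d (c :: l) q.
  move=> pq ql; have : sorted <=%R (c :: l).
    by apply: sub_path pl => ? ? /ltW.
  move=> sl; apply: (sorted_leq_nth le_trans lexx d sl) => //.
  by rewrite inE/= ltnS (leq_trans pq).
case: (ltngtP i j) => // ij.
- have := mono _ _ ij (ltnW jl) => /(lt_le_trans yi)/(lt_trans)/(_ jy).
  by rewrite ltxx.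
- have := mono _ _ ij (ltnW il) => /(lt_le_trans yj)/(lt_trans)/(_ iy).
  by rewrite ltxx.
Qed.

Lemma itv_partition_piece_lt (c d : R) l (i : nat) :
  itv_partition c d l -> (i < size l)%N ->
  nth d (c :: l) i < nth d (c :: l) i.+1.
Proof.
move=> [pl _] il.
have sl : sorted <%R (c :: l) by [].
by apply: (sorted_ltn_nth lt_trans d sl) => //; rewrite inE/= ltnS// ltnW.
Qed.

(** Subdividing each interval of a disjoint family keeps the family disjoint and
    its total length unchanged, so the [delta] of absolute continuity also
    bounds variations over arbitrarily fine partitions of the intervals. *)
Lemma abs_cont_small_variation a b f : abs_cont a b f ->
  forall eps : R, 0 < eps -> exists2 delta : R, 0 < delta &
    forall (I : finType) (s t : I -> R) (l : I -> seq R),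
      (forall i, a <= s i /\ t i <= b) ->
      (forall i, itv_partition (s i) (t i) (l i)) ->
      trivIset setT (fun i => `]s i, t i[%classic) ->
      \sum_i (t i - s i) < delta ->
      \sum_i variation (s i) (t i) f (l i) < eps.
Proof.
move=> acf eps eps0; have [d d0 H] := abs_cont_finType acf eps0.
exists d => // I s t l st pl tI sd.
(* the pieces of all the partitions together *)
pose J := {i : I & 'I_(size (l i))}.
pose S (p : J) := nth (t (tag p)) (s (tag p) :: l (tag p)) (tagged p).
pose T (p : J) := nth (t (tag p)) (s (tag p) :: l (tag p)) (tagged p).+1.
have -> : \sum_i variation (s i) (t i) f (l i) = \sum_p `|f (T p) - f (S p)|.
  under eq_bigr do rewrite /variation big_mkord.
  by rewrite (sig_big_dep xpredT (fun=> xpredT) (fun i (j : 'I_(size (l i))) =>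
    `|f (nth (t i) (s i :: l i) j.+1) - f (nth (t i) (s i :: l i) j)|)).
have bnd p : s (tag p) <= S p /\ T p <= t (tag p).
  split; [apply: itv_partition_nth_ge (pl _)|apply: itv_partition_nth_le (pl _)].
    by rewrite ltnS ltnW.
  by rewrite ltnS.
apply: H.
- move=> p; have [sa tb] := st (tag p); have [sS Tt] := bnd p; split.
  + exact: le_trans sS.
  + by apply/ltW/itv_partition_piece_lt.
  + exact: le_trans Tt _.
- move=> [i j] [i' j'] _ _ [y [/= yp yq]].
  have ii' : i = i'.
    apply: tI => //; exists y; split => /=.
      have /= [sS Tt] := bnd (existT _ i j); move: yp; rewrite !in_itv/=.
      by move=> /andP[/(le_lt_trans sS)-> /lt_le_trans->].
    have /= [sS Tt] := bnd (existT _ i' j'); move: yq; rewrite !in_itv/=.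
    by move=> /andP[/(le_lt_trans sS)-> /lt_le_trans->].
  subst i'; congr existT; apply: val_inj => /=.
  by apply: (itv_partition_pieces_disjoint (pl i)) => //; exists y.
- rewrite (_ : \sum_p _ = \sum_i (t i - s i))//.
  rewrite -(sig_big_dep xpredT (fun=> xpredT) (fun i (j : 'I_(size (l i))) =>
    nth (t i) (s i :: l i) j.+1 - nth (t i) (s i :: l i) j))/=.
  apply: eq_bigr => i _.
  rewrite -(big_mkord xpredT (fun j =>
     nth (t i) (s i :: l i) j.+1 - nth (t i) (s i :: l i) j)).
  by rewrite telescope_sumr//= (itv_partition_nth_size _ (pl i)).
Qed.

(** The interval is cut into finitely many pieces of length at most [d / 2],
    where [d] bounds by 1 the variation over any piece shorter than [d]. *)
Lemma abs_cont_bounded_variation a b f : a <= b -> abs_cont a b f ->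
  bounded_variation a b f.
Proof.
move=> ab acf; have [d d0 H] := abs_cont_small_variation acf ltr01.
have short c e : a <= c -> c <= e -> e <= b -> e - c < d ->
    bounded_variation c e f.
  move=> ac ce eb ced; exists 1 => _ [l pl <-]; apply/ltW.
  have := H unit (fun=> c) (fun=> e) (fun=> l).
  rewrite !big_const !cardT !enumT !unlock/= !addr0; apply => //.
  by move=> [] [].
(* division points, eventually all equal to [b] *)
pose x n := Num.min b (a + (d / 2) *+ n).
have ax n : a <= x n.
  by rewrite /x le_min ab lerDl mulrn_wge0// divr_ge0// ltW.
have xb n : x n <= b by rewrite /x ge_min lexx.
have xx n : x n <= x n.+1.
  rewrite /x le_min !ge_min lexx/=; apply/orP; right.
  by rewrite lerD2l ler_wpMn2l// divr_ge0// ltW.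
have BVx n : bounded_variation a (x n) f.
  elim: n => [|n IH].
    rewrite /x mulr0n addr0 (min_idPr ab); exact: bounded_variationxx.
  apply/(bounded_variationP _ (ax _)).
  rewrite (total_variationD f (ax n) (xx n)) fin_numD; apply/andP; split.
    exact/(bounded_variationP _ (ax _)).
  apply/(bounded_variationP _ (xx _)); apply: short => //.
  rewrite /x mulrSr addrA; set z := a + _.
  rewrite /Num.min; case: (ltP b z) => ?; case: (ltP b (z + d / 2)) => ?; lra.
have [n nP] : exists n, x n = b.
  exists (Num.bound ((b - a) / (d / 2))); apply/min_idPl.
  rewrite -lerBlDl -mulr_natl -ler_pdivrMr ?divr_gt0//.
  by apply/ltW/archi_boundP; rewrite divr_ge0 ?subr_ge0// divr_ge0// ltW.
by rewrite -nP.
Qed.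

Lemma abs_cont_total_variation_fin a b c e f : a <= b -> abs_cont a b f ->
  a <= c -> c <= e -> e <= b -> total_variation c e f \is a fin_num.
Proof.
move=> ab acf ac ce eb; have BVf := abs_cont_bounded_variation ab acf.
apply/(bounded_variationP _ ce)/(bounded_variationl ce eb).
by apply: (bounded_variationr ac _ BVf); exact: le_trans eb.
Qed.

(** Each increment of the total variation is approximated by the variation over
    a partition; [abs_cont_small_variation] controls all of them at once, and
    the [N] approximation errors are chosen to add up to less than [eps / 2]. *)
Lemma abs_cont_total_variation a b f : a <= b -> abs_cont a b f ->
  abs_cont a b (fine \o total_variation a ^~ f).
Proof.
move=> ab acf eps eps0.
have e20 : 0 < eps / 2 by rewrite divr_gt0.
have [d d0 H] := abs_cont_small_variation acf e20.
exists d => // N s t st tI sd.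
have fin c e := @abs_cont_total_variation_fin a b c e f ab acf.
pose e := eps / 2 / N.+1%:R.
have e0 : 0 < e by rewrite !divr_gt0.
have /choice[l lP] : forall i, exists l, itv_partition (s i) (t i) l /\
    fine (total_variation (s i) (t i) f) < variation (s i) (t i) f l + e.
  move=> i; have [asi [sti tib]] := st i.
  have fTV := fin _ _ asi (ltW sti) tib.
  have [_ [_ [l pl <-] <-]] := ub_ereal_sup_adherent e0 fTV.
  rewrite -[X in (X - _ < _)%E](fineK fTV) -EFinB lte_fin => lt; exists l.
  by split => //; rewrite -ltrBlDr.
have step i : `|(fine \o total_variation a ^~ f) (t i) -
    (fine \o total_variation a ^~ f) (s i)| = fine (total_variation (s i) (t i) f).
  have [asi [sti tib]] := st i => /=.
  rewrite (total_variationD f asi (ltW sti)) fineD; last 2 first.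
  - by apply: fin => //; rewrite (le_trans (ltW sti)).
  - by apply: fin => //; exact: ltW.
  by rewrite [X in X - _]addrC addrK ger0_norm// fine_ge0// total_variation_ge0// ltW.
under eq_bigr do rewrite step.
apply: (@le_lt_trans _ _ (\sum_i (variation (s i) (t i) f (l i) + e))).
  by apply: ler_sum => i _; apply/ltW; have [] := lP i.
rewrite big_split/= sumr_const card_ord [ltRHS]splitr ltrD//.
  apply: H => // i; first by have [? [_ ?]] := st i.
  by have [] := lP i.
rewrite -[e *+ N]mulr_natr /e -[ltLHS]mulrA gtr_pMr ?divr_gt0//.
by rewrite mulrC ltr_pdivrMr// mul1r ltr_nat.
Qed.

End absolute_continuity.

(** * Monotone decomposition and extension to the whole line *)

Section clamp.
Context {R : realType}.
Implicit Types (a b : R) (f : R -> R).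

(** Composing with the projection onto [[a, b]] extends a function continuously
    from [[a, b]] to the line, by constants. *)
Definition clamp a b (x : R) := Num.max a (Num.min x b).

Lemma clamp_id a b x : a <= x -> x <= b -> clamp a b x = x.
Proof. by move=> ax xb; rewrite /clamp (min_idPl xb) (max_idPr ax). Qed.

Lemma clamp_ge a b x : a <= clamp a b x.
Proof. by rewrite /clamp le_max lexx. Qed.

Lemma clamp_le a b x : a <= b -> clamp a b x <= b.
Proof. by move=> ab; rewrite /clamp ge_max ab ge_min lexx orbT. Qed.

Lemma clamp_homo a b : {homo clamp a b : x y / x <= y}.
Proof.
move=> x y xy; rewrite /clamp ge_max le_max lexx/= le_max le_min !ge_min xy.
by rewrite lexx orbT/= orbT.
Qed.

Lemma clamp_sub_le a b x y : a <= b -> x <= y ->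
  clamp a b y - clamp a b x <= y - x.
Proof.
move=> ab xy; rewrite /clamp /Num.max /Num.min.
case: (ltP y b) => yb; case: (ltP x b) => xb;
 (case: ltP => h1; case: ltP => h2); lra.
Qed.

Lemma clamp_itv a b s t : a <= b ->
  `]clamp a b s, clamp a b t[%classic `<=` `]s, t[%classic.
Proof.
move=> ab y /=; rewrite !in_itv/= => /andP[sy yt].
have yab : clamp a b y = y.
  apply: clamp_id; first exact: le_trans (clamp_ge _ _ _) (ltW sy).
  exact: le_trans (ltW yt) (clamp_le _ ab).
apply/andP; split; rewrite ltNge; apply/negP => /(clamp_homo a b).
  by rewrite yab leNgt sy.
by rewrite yab leNgt yt.
Qed.

Lemma abs_cont_clamp a b f : a <= b -> abs_cont a b f ->
  forall eps : R, 0 < eps -> exists2 delta : R, 0 < delta &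
    forall (I : finType) (s t : I -> R),
      (forall i, s i <= t i) ->
      trivIset setT (fun i => `]s i, t i[%classic) ->
      \sum_i (t i - s i) < delta ->
      \sum_i `|f (clamp a b (t i)) - f (clamp a b (s i))| < eps.
Proof.
move=> ab acf eps eps0; have [d d0 H] := abs_cont_finType acf eps0.
exists d => // I s t st tI sd.
apply: (H I (clamp a b \o s) (clamp a b \o t)) => /=.
- by move=> i; split; [exact: clamp_ge|exact: clamp_homo|exact: clamp_le].
- move=> i j _ _ [y [/= yi yj]]; apply: tI => //; exists y.
  by split; apply: clamp_itv yi || apply: clamp_itv yj.
- apply: le_lt_trans sd; apply: ler_sum => i _; exact: clamp_sub_le.
Qed.

Lemma abs_cont_clamp_continuous a b f : a <= b -> abs_cont a b f ->
  continuous (f \o clamp a b).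
Proof.
move=> ab acf x; apply/cvgrPdist_lt => e e0.
have [d d0 H] := abs_cont_clamp ab acf e0.
near=> y.
have one s t : s <= t -> t - s < d -> `|f (clamp a b t) - f (clamp a b s)| < e.
  move=> st std; have := H unit (fun=> s) (fun=> t).
  rewrite !big_const !cardT !enumT !unlock/= !addr0; apply => //.
  by move=> [] [].
have xyd : `|x - y| < d by near: y; exact: (nbhsx_ballx x d d0).
have [xy|yx] := leP x y.
  by rewrite /= distrC; apply: one => //; rewrite (le_lt_trans (ler_norm _))// distrC.
by apply: one; [exact: ltW|rewrite (le_lt_trans (ler_norm _))].
Unshelve. all: by end_near. Qed.

Lemma abs_contB a b f g : abs_cont a b f -> abs_cont a b g ->
  abs_cont a b (f \- g).
Proof.
move=> acf acg eps eps0; have e20 : 0 < eps / 2 by rewrite divr_gt0.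
have [d d0 H] := acf _ e20; have [d' d'0 H'] := acg _ e20.
exists (Num.min d d'); first by rewrite lt_min d0.
move=> N s t st tI; rewrite lt_min => /andP[sd sd'].
apply: (@le_lt_trans _ _
  (\sum_i (`|f (t i) - f (s i)| + `|g (t i) - g (s i)|))).
  apply: ler_sum => i _ /=; rewrite (_ : _ - _ - _ =
    (f (t i) - f (s i)) - (g (t i) - g (s i))); last by ring.
  exact: ler_normB.
by rewrite big_split/= [ltRHS]splitr ltrD ?H ?H'.
Qed.

(** An increment of [f] is at most the total variation over the same interval,
    so [f] is the difference of the nondecreasing functions [V] and [V - f],
    with [V] the total variation from [a]. *)
Lemma total_variation_minus_nondecreasing a b f : a <= b -> abs_cont a b f ->
  {in `[a, b] &, nondecreasing_fun (fine \o total_variation a ^~ f)} /\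
  {in `[a, b] &, nondecreasing_fun ((fine \o total_variation a ^~ f) \- f)}.
Proof.
move=> ab acf.
have fin c e := @abs_cont_total_variation_fin _ a b c e f ab acf.
have step x y : x \in `[a, b] -> y \in `[a, b] -> x <= y ->
    fine (total_variation a x f) + `|f y - f x| <= fine (total_variation a y f).
  rewrite !in_itv/= => /andP[ax xb] /andP[ay yb] xy.
  rewrite (total_variationD f ax xy) fineD ?fin// lerD2l.
  by rewrite -lee_fin fineK ?fin//; exact: total_variation_ge.
split => x y xab yab xy /=; have := step _ _ xab yab xy.
  by apply: le_trans; rewrite lerDl.
have := ler_norm (f y - f x); lra.
Qed.

End clamp.

Section open_interval.
Context {R : realType}.
Local Notation mu := (@lebesgue_measure R).

Lemma open_finite_interval (J : set R) : open J -> is_interval J ->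
  (mu J < +oo)%E -> exists s t, s <= t /\ J = `]s, t[%classic.
Proof.
move=> oJ /is_intervalP JE.
have [->|/set0P J0] := eqVneq J set0.
  by move=> _; exists 0, 0; rewrite set_itvoo0.
move: oJ J0; rewrite JE lebesgue_measure_itv.
case: (Rhull J) => -[bx x|[|]] [bY y|[|]] oJ J0 /=; rewrite ?ltry ?ltNyr ?ltxx//;
  try (by move: J0; rewrite set_itvE => -[]).
move=> _.
have [xy|yx] := ltP x y.
  exists x, y; split; first exact: ltW.
  by move/interior_id : oJ => <-; rewrite interior_itv_bnd.
exfalso; move: J0 => [z Jz]; have [e /= e0 eJ] := oJ z Jz.
have := eJ (z + e / 2); rewrite /ball/= opprD addNKr normrN gtr0_norm ?divr_gt0//.
have e2 : 0 < e / 2 by rewrite divr_gt0.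
rewrite gtr_pMr// invf_lt1// ltr1n => /(_ isT).
move: Jz; rewrite /= !itv_boundlr => /andP[xz _] /andP[_ zy].
have xz' : x <= z by move: xz; case: (bx) => //= /ltW.
have zy' : z + e / 2 <= y by move: zy; case: (bY) => //= /ltW.
clear JE; lra.
Qed.
End open_interval.

(** * Stieltjes measures of absolutely continuous functions *)

Section stieltjes_density.
Context {R : realType}.
Local Notation mu := (@lebesgue_measure R).

Lemma measure_monotone (m : {measure set (measurableTypeR R) -> \bar R})
    A B :
  measurable A -> measurable B -> A `<=` B -> (m A <= m B)%E.
Proof. by move=> mA mB; apply: le_measure; exact: mem_set. Qed.

Lemma lebesgue_stieltjes_measure_itvoc (G : cumulative R R) (s t : R) :
  s <= t -> lebesgue_stieltjes_measure G (`]s, t]%classic : set R) =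
            (G t - G s)%:E.
Proof.
move=> st.
rewrite /lebesgue_stieltjes_measure/= /measure_extension/=.
rewrite measurable_mu_extE//; last exact: is_ocitv.
exact: (wlength_itv_bnd G false false st).
Qed.

(** A null set lies in an open set of small Lebesgue measure.  This open set is
    a countable disjoint union of open intervals, and absolute continuity bounds
    the Stieltjes mass of every finite subfamily. *)
Lemma abs_cont_dominates a b (g : R -> R) (G : cumulative R R) : a <= b ->
  abs_cont a b g -> (G : R -> R) = g \o clamp a b ->
  lebesgue_stieltjes_measure G `<< mu.
Proof.
move=> ab acg GE; apply/null_content_dominatesP => A mA A0.
apply/eqP; rewrite eq_le measure_ge0 andbT.
apply/lee_addgt0Pr => eps eps0; rewrite add0e.
have [d d0 H] := abs_cont_clamp ab acg eps0.
have [|U [oU AU Ud]] := @lebesgue_regularity_outer R A d mA _ d0.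
  by rewrite A0 ltry.
have mU : measurable U by exact: open_measurable.
have {Ud} Ud : (mu U < d%:E)%E.
  have -> : (mu U = mu (U `\` A) + mu (U `&` A))%E by exact: measureDI.
  rewrite [X in (_ + X)%E](_ : _ = 0%E) ?adde0//.
  by apply/eqP; rewrite eq_le measure_ge0 andbT -A0 measureIr.
pose I := open_disjoint_itv oU.
have IU q : I q `<=` U.
  by rewrite [X in _ `<=` X](open_disjoint_itv_bigcup oU); exact: bigcup_sup.
have mI q : measurable (I q) by apply: open_measurable; exact: open_disjoint_itv_open.
have tI : trivIset setT I by exact: open_disjoint_itv_trivIset.
have /choice[st stP] : forall q, exists st : R * R,
    st.1 <= st.2 /\ I q = `]st.1, st.2[%classic.
  move=> q.
  have [|||s [t [? ?]]] := @open_finite_interval _ (I q).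
  - exact: open_disjoint_itv_open.
  - exact: open_disjoint_itv_is_interval.
  - rewrite (@le_lt_trans _ _ (mu U)) ?(lt_trans Ud) ?ltry//.
    exact: measure_monotone (mI q) mU (IU q).
  - by exists (s, t).
have measU (m : {measure set (measurableTypeR R) -> \bar R}) :
    m U = (\sum_(q <oo) m (I q))%E.
  rewrite {1}(open_disjoint_itv_bigcup oU) measure_semi_bigcup//.
  by apply: bigcup_measurable => q _; exact: mI.
apply: (@le_trans _ _ (lebesgue_stieltjes_measure G U)).
  exact: measure_monotone mA mU AU.
rewrite measU; apply: lime_le; first exact: is_cvg_nneseries.
apply: nearW => n; rewrite big_mkord.
apply: (@le_trans _ _ (\sum_(q < n) (G (st q).2 - G (st q).1)%:E)%E).
  apply: lee_sum => q _; have [le ->] := stP q.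
  rewrite -lebesgue_stieltjes_measure_itvoc//; apply: measure_monotone => //.
  exact: subset_itv_oo_oc.
rewrite sumEFin lee_fin; apply/ltW.
apply: (@le_lt_trans _ _ (\sum_(q < n) `|G (st q).2 - G (st q).1|)).
  by apply: ler_sum => q _; exact: ler_norm.
rewrite GE; apply: (H 'I_n (fun q => (st q).1) (fun q => (st q).2)).
- by move=> q; have [] := stP q.
- move=> i j _ _ ij; apply/val_inj/tI => //=.
  by have [_ iE] := stP i; have [_ jE] := stP j; rewrite -/I iE jE.
- rewrite -lte_fin; apply: le_lt_trans Ud; rewrite measU.
  apply: le_trans (nneseries_lim_ge n _) => //; rewrite big_mkord -sumEFin.
  apply: lee_sum => q _; have [le ->] := stP q.
  rewrite [X in (_ <= X)%E](lebesgue_measure_itv `](st q).1, (st q).2[)/= lte_fin.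
  by case: ltP => //= ts; rewrite lee_fin subr_le0.
Qed.

(** The Radon-Nikodym theorem applies to the Stieltjes measure of the extension
    of [g], restricted to [`]a, b]] in order to be finite. *)
Lemma nondecreasing_abs_cont_density a b (g : R -> R) : a <= b ->
  {in `[a, b] &, nondecreasing_fun g} -> abs_cont a b g ->
  exists h : R -> R, mu.-integrable setT (EFin \o h) /\
    forall x y, a <= x -> x <= y -> y <= b ->
      g y - g x = \int[mu]_(u in `]x, y]) h u.
Proof.
move=> ab ndg acg; pose G0 := g \o clamp a b.
have cin x : clamp a b x \in `[a, b].
  by rewrite in_itv/= clamp_ge clamp_le.
have nd : nondecreasing G0 by move=> x y xy; apply: ndg => //; exact: clamp_homo.
have rc := right_continuousW (abs_cont_clamp_continuous ab acg).
pose G : cumulative R R := HB.pack G0 (isCumulative.Build R _ R G0 nd rc).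
have dom := @abs_cont_dominates a b g G ab acg erefl.
have mD : measurable (`]a, b]%classic : set (measurableTypeR R)) by [].
have Doo : (lebesgue_stieltjes_measure G (`]a, b]%classic : set R) < +oo)%E.
  by rewrite lebesgue_stieltjes_measure_itvoc// ltry.
pose nu := mfrestr mD Doo.
have numu : nu `<< mu.
  apply/null_content_dominatesP => A mA A0; rewrite /nu /mfrestr /mrestr.
  move/null_content_dominatesP : dom; apply; first exact: measurableI.
  apply/eqP; rewrite eq_le measure_ge0 andbT -A0; apply: measure_monotone => //.
  exact: measurableI.
have [h [h0 hfin inth hE]] := radon_nikodym_sigma_finite numu.
exists (fine \o h).
have hK : EFin \o (fine \o h) = h by apply/funext => x /=; rewrite fineK.
split; first by rewrite hK.
move=> x y ax xy yb; rewrite /Rintegral.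
under eq_integral do rewrite fineK//.
rewrite -hE//.
change (g y - g x = fine (lebesgue_stieltjes_measure G
  (`]x, y]%classic `&` `]a, b]%classic))).
rewrite setIidl; last first.
  by apply: subset_itv; rewrite bnd_simp.
rewrite lebesgue_stieltjes_measure_itvoc//= /G0/= !clamp_id//.
  exact: le_trans yb.
exact: le_trans xy.
Qed.

End stieltjes_density.

(** * Recovering an absolutely continuous function from its derivative *)

Section abs_cont_ftc.
Context {R : realType}.
Local Notation mu := (@lebesgue_measure R).

Lemma ae_neq (c : R) : {ae mu, forall x, x != c}.
Proof.
exists [set c]; split => //; first exact: lebesgue_measure_set1.
by move=> x /= /negP; rewrite negbK => /eqP.
Qed.

(** With [h] the difference of the densities of the two monotone parts, [f] is an
    indefinite integral of [h]; its derivative is [h] at the Lebesgue points. *)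
Theorem abs_cont_ftc a b (f : R -> R) : a <= b -> abs_cont a b f ->
  exists h : R -> R, [/\ mu.-integrable setT (EFin \o h),
    forall x y, a <= x -> x <= y -> y <= b ->
      f y - f x = \int[mu]_(u in `]x, y]) h u &
    {ae mu, forall x, a < x -> x < b -> derive1 f x = h x}].
Proof.
move=> ab acf.
have [ndV ndVf] := total_variation_minus_nondecreasing ab acf.
have acV := abs_cont_total_variation ab acf.
have [h1 [ih1 h1E]] := nondecreasing_abs_cont_density ab ndV acV.
have [h2 [ih2 h2E]] :=
  nondecreasing_abs_cont_density ab ndVf (abs_contB acV acf).
pose h := h1 \- h2.
have ih : mu.-integrable setT (EFin \o h).
  by rewrite (_ : _ \o _ = (EFin \o h1) \- (EFin \o h2))%E//; exact: integrableB.
have hE x y : a <= x -> x <= y -> y <= b ->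
    f y - f x = \int[mu]_(u in `]x, y]) h u.
  move=> ax xy yb; rewrite RintegralB//; last 2 first.
    exact: integrableS ih1.
    exact: integrableS ih2.
  by rewrite -h1E// -h2E//=; ring.
exists h; split => //.
have loch : locally_integrable setT h.
  by apply: open_integrable_locally => //; exact: openT.
have inth y : mu.-integrable [set` Interval (BRight a) (BRight y)] (EFin \o h).
  exact: integrableS ih.
have := FTC1 inth loch.
apply: filterS; first exact: (ae_filter_ringOfSetsType mu).
move=> x + ax xb => /(_ ax) [dF <-].
rewrite !derive1E.
set F := fun y => _ in dF *.
have dFc : is_derive x 1 (F \+ cst (f a)) ('D_1 F x).
  rewrite -[X in is_derive _ _ _ X]addr0.
  exact: is_deriveD (derivableP dF) (is_derive_cst _ _ _).
apply: derive_val; apply: near_eq_is_derive dFc.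
near=> y; rewrite /= /F -hE ?lexx ?subrK//.
- by apply/ltW; near: y; exact: lt_nbhsr.
- by apply/ltW; near: y; exact: lt_nbhsl.
Unshelve. all: by end_near. Qed.

Lemma abs_cont_integrable_derive1 a b (f : R -> R) : a <= b ->
  abs_cont a b f -> measurable_fun `[a, b] (derive1 f) ->
  mu.-integrable `[a, b] (EFin \o derive1 f) /\
  forall x y, a <= x -> x <= y -> y <= b ->
    `|f y - f x| <= \int[mu]_(u in `[x, y]) `|derive1 f u|.
Proof.
move=> ab acf mf'; have [h [ih hE hf']] := abs_cont_ftc ab acf.
(* the value of [derive1 f] at the endpoints is irrelevant for integrals *)
have ae : {ae mu, forall x, a <= x <= b -> derive1 f x = h x}.
  have na := ae_neq a; have nb := ae_neq b.
  move: na nb hf'; apply: filterS3; first exact: (ae_filter_ringOfSetsType mu).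
  move=> x xa xb fx /andP[ax bx].
  by apply: fx; rewrite lt_neqAle ?ax ?bx ?xb// eq_sym xa.
have mh : measurable_fun setT h by apply/measurable_EFinP; exact: measurable_int ih.
have intE x y : a <= x -> y <= b -> 
    (\int[mu]_(u in `[x, y]) `|derive1 f u|%:E =
    \int[mu]_(u in `[x, y]) `|h u|%:E)%E.
  move=> ax yb; apply: ae_eq_integral => //.
  - apply/measurable_EFinP/measurableT_comp => //.
    by apply: measurable_funS mf' => //; apply: subset_itv; rewrite bnd_simp.
  - by apply/measurable_EFinP/measurableT_comp => //; exact: measurable_funTS.
  - apply: filterS ae; first exact: (ae_filter_ringOfSetsType mu).
    move=> u fu /=; rewrite in_itv/= => /andP[xu uy].
    by rewrite fu// (le_trans ax xu) (le_trans uy).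
split.
  apply/integrableP; split; first exact/measurable_EFinP.
  have /integrableP[_] : mu.-integrable `[a, b] (EFin \o h).
    exact: integrableS ih.
  by rewrite -intE.
move=> x y ax xy yb; rewrite hE//.
apply: (le_trans (le_normr_Rintegral _ _)) => //.
  exact: integrableS ih.
rewrite Rintegral_itv_obnd_cbnd; last first.
  have ihxy : mu.-integrable `]x, y] (EFin \o h) by exact: integrableS ih.
  exact: integrable_norm ihxy.
by rewrite /Rintegral intE.
Qed.
End abs_cont_ftc.

(** * Convex phi-functions and the density of a sigmoidal function *)

Section convex.
Context {R : realType}.
Implicit Types (phi : R -> R).

Lemma phi_ge0 phi : phi_function phi -> forall y, 0 <= y -> 0 <= phi y.
Proof. by move=> Pphi y y0; rewrite -(phi_0 Pphi) (phi_ndecr Pphi). Qed.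

Lemma convex_nnegP phi : convex_nneg phi -> forall x y t,
  0 <= x -> 0 <= y -> 0 <= t -> t <= 1 ->
  phi (t * x + (1 - t) * y) <= t * phi x + (1 - t) * phi y.
Proof.
move=> cphi x y t x0 y0 t0 t1.
have := cphi (Itv01 t0 t1) x y; rewrite !inE/= !in_itv/= !andbT.
by move=> /(_ x0 y0); rewrite !convRE.
Qed.

Lemma convex_nneg_scale phi : convex_nneg phi -> phi 0 = 0 ->
  forall t x, 0 <= t -> t <= 1 -> 0 <= x -> phi (t * x) <= t * phi x.
Proof.
move=> cphi phi0 t x t0 t1 x0.
have := convex_nnegP cphi x0 (lexx 0) t0 t1.
by rewrite phi0 !mulr0 !addr0.
Qed.

(** Jensen's inequality is used through supporting lines: [s] is the supremum of
    the slopes of the chords that end at [m].  It is nonnegative because [phi]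
    is nondecreasing. *)
Lemma convex_nneg_affine_minorant phi : phi_function phi -> convex_nneg phi ->
  forall m, 0 <= m -> exists2 s, 0 <= s &
    forall y, 0 <= y -> phi m + s * (y - m) <= phi y.
Proof.
move=> Pphi cphi m; rewrite le_eqVlt => /predU1P[<-|m0].
  exists 0 => // y y0; rewrite mul0r addr0.
  exact: (phi_ndecr Pphi).
pose S := [set (phi m - phi y) / (m - y) | y in `[0, m[%classic].
have slopes y z : 0 <= y -> y < m -> m < z ->
    (phi m - phi y) / (m - y) <= (phi z - phi m) / (z - m).
  move=> y0 ym mz.
  have ym0 : 0 < m - y by rewrite subr_gt0.
  have mz0 : 0 < z - m by rewrite subr_gt0.
  have yz0 : 0 < z - y by rewrite subr_gt0 (lt_trans ym).
  rewrite ler_pdivrMr// mulrAC ler_pdivlMr//.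
  have z0 : 0 <= z by rewrite (le_trans _ (ltW mz))// ltW.
  have t0 : 0 <= (z - m) / (z - y) by rewrite divr_ge0// ltW.
  have t1 : (z - m) / (z - y) <= 1 by rewrite ler_pdivrMr// mul1r; lra.
  have := convex_nnegP cphi y0 z0 t0 t1.
  (* [m] as a convex combination of [y] and [z] *)
  have -> : (z - m) / (z - y) * y + (1 - (z - m) / (z - y)) * z = m.
    by field; rewrite gt_eqF.
  have -> : (z - m) / (z - y) * phi y + (1 - (z - m) / (z - y)) * phi z =
    ((z - m) * phi y + (m - y) * phi z) / (z - y).
    by field; rewrite gt_eqF.
  rewrite ler_pdivlMr//; lra.
have S0 : S ((phi m - phi 0) / (m - 0)).
  by exists 0 => //=; rewrite in_itv/= lexx.
have ubS z : m < z -> ubound S ((phi z - phi m) / (z - m)).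
  move=> mz _ [y /= + <-]; rewrite in_itv/= => /andP[y0 ym].
  exact: slopes.
have hsS : has_sup S.
  split; first by eexists; exact: S0.
  by exists ((phi (m + 1) - phi m) / (m + 1 - m)); apply: ubS; rewrite ltrDl.
exists (sup S) => [|y y0].
  apply: le_trans (ub_le_sup hsS.2 S0); rewrite divr_ge0// ?subr0 ?(ltW m0)//.
  by rewrite subr_ge0 (phi_ndecr Pphi)// ltW.
have [ym|my|->] := ltgtP y m; last by rewrite subrr mulr0 addr0.
- have : (phi m - phi y) / (m - y) <= sup S.
    by apply: (ub_le_sup hsS.2); exists y => //=; rewrite in_itv/= y0.
  rewrite ler_pdivrMr ?subr_gt0//; lra.
- have : sup S <= (phi y - phi m) / (y - m) by apply: ge_sup hsS.1 (ubS _ my).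
  rewrite ler_pdivlMr ?subr_gt0//; lra.
Qed.

(** [phi (w) >= phi 1 * w] for [w >= 1], as [phi 0 = 0] and [phi] is convex; the
    added [phi 1] covers [w <= 1].  This bounds second moments by [M_{0,2}]. *)
Lemma sqr_le_phi phi : phi_function phi -> convex_nneg phi ->
  forall v, phi 1 * v ^+ 2 <= phi 1 + phi (v ^+ 2).
Proof.
move=> Pphi cphi v; set w := v ^+ 2; have w0 : 0 <= w by exact: sqr_ge0.
have phi1 := phi_gt0 Pphi ltr01.
have phiw := phi_ge0 Pphi w0.
have [w1|w1] := leP w 1.
  have : phi 1 * w <= phi 1 * 1 by rewrite ler_pM2l.
  lra.
have wp : 0 < w by exact: lt_trans w1.
have := convex_nneg_scale cphi (phi_0 Pphi) (t := w^-1) (x := w).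
rewrite mulVf ?gt_eqF// invr_ge0 w0 invf_le1// (ltW w1) => /(_ isT isT isT).
rewrite mulrC ler_pdivlMr//; lra.
Qed.

Lemma measurable_phi_norm phi : phi_function phi ->
  measurable_fun setT (fun x : R => phi `|x|).
Proof.
move=> Pphi; pose p x := phi (Num.max 0 x).
have mp : measurable_fun setT p.
  apply: nondecreasing_measurable => // x y xy; apply: (phi_ndecr Pphi).
    by rewrite le_max lexx.
  by rewrite ge_max le_max lexx/= le_max xy orbT.
rewrite (_ : (fun _ => _) = p \o Num.Def.normr).
  exact: measurableT_comp.
by apply/funext => x; rewrite /p/= (max_idPr _).
Qed.

End convex.

Section density.
Context {R : realType}.
Implicit Types (sigma : R -> R).

Lemma density_ge0 sigma : sigmoidal sigma -> forall x, 0 <= density sigma x.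
Proof.
move=> Ps x; rewrite mulr_ge0 ?invr_ge0// subr_ge0 (sigmoidal_ndecr Ps)//.
lra.
Qed.

Lemma measurable_density sigma : sigmoidal sigma ->
  measurable_fun setT (density sigma).
Proof.
move=> Ps; have ms := sigmoidal_measurable Ps.
apply: measurable_funM => //; apply: measurable_funB.
- by apply: measurableT_comp => //; exact: measurable_funD.
- by apply: measurableT_comp => //; exact: measurable_funB.
Qed.

(** Equality would make the concave function [sigma] bounded by [sigma 1 < 1] on
    [[2, +oo[], against its limit 1. *)
Lemma sigmoidal_ltr12 sigma : sigmoidal sigma -> sigma 1 < sigma 2.
Proof.
move=> Ps; rewrite ltNge; apply/negP => s21.
have [x [x2 sx]] : exists x, 2 < x /\ sigma 1 < sigma x.
  have near1 : \forall x \near +oo, sigma 1 < sigma x.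
    by apply: (cvgr_gt _ (sigmoidal_cvgy Ps)); exact: sigmoidal_lt1.
  near (+oo : set_system R) => x; exists x; split; near: x => //.
  exact: nbhs_pinfty_gt.
pose t := (x - 2) / (x - 1).
have x1 : 0 < x - 1 by lra.
have t0 : 0 <= t by rewrite divr_ge0//; lra.
have t1 : t <= 1 by rewrite ler_pdivrMr//; lra.
have x0 : 0 <= x by lra.
have := convex_nnegP (sigmoidal_concave Ps) (@ler01 R) x0 t0 t1.
have -> : t * 1 + (1 - t) * x = 2 by rewrite /t; field; rewrite gt_eqF.
have : t < 1 by rewrite ltr_pdivrMr//; lra.
nra.
Unshelve. all: by end_near. Qed.

(** By concavity the increments of [sigma] over unit intervals decrease on
    [[0, +oo[], and for [0 <= v <= 2] the interval [[v - 1, v + 1]] contains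
    [[0, 1]] or [[1, 2]].  Negative [v] are handled by the parity of the
    density. *)
Lemma density_lb sigma : sigmoidal sigma ->
  exists2 c : R, 0 < c & forall v, `|v| <= 2 -> c <= density sigma v.
Proof.
move=> Ps; have s12 := sigmoidal_ltr12 Ps.
have nd := sigmoidal_ndecr Ps.
have s01 : sigma 2 - sigma 1 <= sigma 1 - sigma 0.
  have h0 : 0 <= 2^-1 :> R by lra.
  have h1 : 2^-1 <= 1 :> R by lra.
  have := convex_nnegP (sigmoidal_concave Ps) (lexx 0) (ler0n R 2) h0 h1.
  have -> : 2^-1 * 0 + (1 - 2^-1) * 2 = 1 :> R by field.
  lra.
have pos v : 0 <= v -> v <= 2 -> sigma 2 - sigma 1 <= sigma (v + 1) - sigma (v - 1).
  move=> v0 v2; have [v1|v1] := leP v 1.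
    have := nd (v - 1) 0; have := nd 1 (v + 1).
    rewrite lerDr v0 subr_le0 v1 => /(_ isT) ? /(_ isT) ?; lra.
  have := nd (v - 1) 1; have := nd 2 (v + 1).
  by move=> /(_ ltac:(lra)) ? /(_ ltac:(lra)) ?; lra.
exists (2^-1 * (sigma 2 - sigma 1)); first by rewrite mulr_gt0 ?subr_gt0// invr_gt0.
move=> v; rewrite ler_norml => /andP[v2 v2'].
rewrite ler_pM2l ?invr_gt0//; have [v0|v0] := leP 0 v; first exact: pos.
have := pos (- v); rewrite oppr_ge0 (ltW v0) lerNl v2 => /(_ isT isT).
have := sigmoidal_odd Ps (v + 1); have := sigmoidal_odd Ps (v - 1).
rewrite !opprD opprK [- v + 1]addrC -[- v - 1]addrC addrC; lra.
Qed.

End density.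

(** * Cells, indices and moments *)

Section Kindex.
Context {R : realType}.
Implicit Types (a b : R) (n : nat).

Lemma admissible_gt0 a b n : admissible a b n -> (0 < n)%N.
Proof.
by rewrite /admissible; case: n => //; rewrite !mul0r ceil0 floor0.
Qed.

Lemma finite_Kindex a b n : finite_set (Kindex a b n).
Proof.
set l := Num.ceil (n%:R * a); set h := Num.floor (n%:R * b) - 1.
pose s := [seq l + i%:Z | i <- iota 0 `|h - l|%N.+1].
apply: (@sub_finite_set _ _ [set` s]); last exact: finite_seq.
move=> k /= /andP[lk kh]; apply/mapP; exists `|k - l|%N; last first.
  by rewrite gez0_abs ?subr_ge0// subrKC.
rewrite mem_iota add0n/= ltnS -lez_nat !gez0_abs ?subr_ge0 ?lerD2r//.
exact: le_trans kh.
Qed.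

Lemma Kindex_itv a b n k : (0 < n)%N -> Kindex a b n k ->
  a <= k%:~R / n%:R /\ (k + 1)%:~R / n%:R <= b.
Proof.
move=> n0 /= /andP[]; rewrite ceil_le_int lerBrDr floor_ge_int => ak kb.
by rewrite ler_pdivlMr ?ltr0n// ler_pdivrMr ?ltr0n// mulrC ak mulrC.
Qed.

(** The floor of [n x] is the natural choice.  It is off the index set by less
    than one step on the left, and by at most one step on the right, where the
    last index is [floor (n b) - 1]; hence the bound 2. *)
Lemma Kindex_near a b n x : admissible a b n -> a <= x -> x <= b ->
  exists2 k, Kindex a b n k & `|n%:R * x - k%:~R| <= 2.
Proof.
move=> adm ax xb; rewrite /Kindex/=; move: adm; rewrite /admissible.
have nax : n%:R * a <= n%:R * x by rewrite ler_wpM2l.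
have nxb : n%:R * x <= n%:R * b by rewrite ler_wpM2l.
have ca := ceilB1_lt (n%:R * a); have ca' := ceil_ge (n%:R * a).
have fb := floorD1_gt (n%:R * b); have fb' := floor_le (n%:R * b).
have fx := floorD1_gt (n%:R * x); have fx' := floor_le (n%:R * x).
set l := Num.ceil _ in ca ca' *; set h := Num.floor (_ * b) in fb fb' *.
set j := Num.floor _ in fx fx' => lh.
rewrite intrB in ca; rewrite intrD in fb; rewrite intrD in fx.
have [lj|jl] := leP l j; last first.
  exists l; first by rewrite lexx.
  have : (j + 1)%:~R <= l%:~R :> R by rewrite ler_int lezD1.
  rewrite intrD ler_norml; lra.
have [jh|hj] := leP j (h - 1).
  by exists j; [rewrite lj|rewrite ler_norml; lra].
exists (h - 1); first by rewrite lh lexx.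
have : (h - 1)%:~R <= j%:~R :> R by rewrite ler_int ltW.
rewrite intrB ler_norml; lra.
Qed.

End Kindex.

Section moment.
Context {R : realType}.
Variables (sigma phi : R -> R).

Lemma moment_sum_le (u : R) (K : set int) : finite_set K ->
  ((\sum_(k \in K) density sigma (u - k%:~R) * phi ((u - k%:~R) ^+ 2))%:E <=
   moment phi 0 2 (density sigma))%E.
Proof.
move=> finK; apply: le_trans; last first.
  by apply: ereal_sup_ubound; exists u.
rewrite -fsumEFin//; apply: esum_ge; exists K => //.
rewrite le_eqVlt; apply/orP; left; apply/eqP.
apply: eq_fsbigr => k _; rewrite powRr0 mulr1.
by rewrite -[2 in RHS]/(2%:R) powR_mulrn// real_normK// num_real.
Qed.

Lemma moment_bound : (moment phi 0 2 (density sigma) < +oo)%E ->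
  exists2 M : R, 0 <= M & forall u K, finite_set K ->
   \sum_(k \in K) density sigma (u - k%:~R) * phi ((u - k%:~R) ^+ 2) <= M.
Proof.
move=> Moo; have M0 : (0 <= moment phi 0 2 (density sigma))%E.
  by have := moment_sum_le 0 (finite_set0 int); rewrite fsbig_set0.
exists (fine (moment phi 0 2 (density sigma))); first exact: fine_ge0.
move=> u K /moment_sum_le-/(_ u).
by rewrite -{1}(@fineK _ (moment phi 0 2 (density sigma))) ?lee_fin// ge0_fin_numE.
Qed.

End moment.

(** * Estimates on one interval *)

Section core.
Context {R : realType}.
Local Notation mu := (@lebesgue_measure R).

Lemma abs_cont_integrable a b (f : R -> R) : a <= b -> abs_cont a b f ->
  mu.-integrable `[a, b] (EFin \o f).
Proof.
move=> ab acf.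
apply: (@eq_integrable _ _ _ mu _ _ (EFin \o (f \o clamp a b))) => //.
  move=> x; rewrite inE/= in_itv/= => /andP[ax xb].
  by rewrite clamp_id.
apply: continuous_compact_integrable; first exact: segment_compact.
exact/continuous_subspaceT/abs_cont_clamp_continuous.
Qed.

Lemma Rintegral_itv_cst (p q r : R) : p <= q ->
  \int[mu]_(_ in `[p, q]) r = r * (q - p).
Proof.
move=> pq; rewrite Rintegral_cst//= lebesgue_measure_itv/= lte_fin.
by case: ltP => // qp; rewrite (_ : q - p = 0)//; apply/eqP; rewrite subr_eq0 eq_le qp.
Qed.

Lemma integrable_itv_cst (p q r : R) :
  mu.-integrable `[p, q] (EFin \o cst r).
Proof.
apply: continuous_compact_integrable; first exact: segment_compact.
by apply: continuous_subspaceT => x; exact: cvg_cst.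
Qed.

Lemma subset_itvcc (a b p q : R) : a <= p -> q <= b ->
  `[p, q]%classic `<=` `[a, b]%classic.
Proof. by move=> ap qb; apply: subset_itv; rewrite bnd_simp. Qed.

Lemma cell_average_deviation a b (f : R -> R) c d x : a <= b ->
  abs_cont a b f -> measurable_fun `[a, b] (derive1 f) ->
  a <= c -> c < d -> d <= b -> a <= x -> x <= b ->
  `|(d - c)^-1 * (\int[mu]_(u in `[c, d]) f u) - f x| <=
  \int[mu]_(t in `[Num.min x c, Num.max x d]) `|derive1 f t|.
Proof.
move=> ab acf mf' ac cd db ax xb.
have [if' Hf] := abs_cont_integrable_derive1 ab acf mf'.
set B := \int[mu]_(t in _) `|_|.
have am : a <= Num.min x c by rewrite le_min ax.
have Mb : Num.max x d <= b by rewrite ge_max xb.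
have sub_le p q : Num.min x c <= p -> q <= Num.max x d ->
    \int[mu]_(t in `[p, q]) `|derive1 f t| <= B.
  move=> mp qM; rewrite fine_le//.
  - apply: integrable_fin_num => //.
    have ii : mu.-integrable `[p, q] (EFin \o derive1 f).
      apply: integrableS if' => //.
      by apply: subset_itvcc; [exact: le_trans mp|exact: le_trans Mb].
    exact: integrable_norm ii.
  - apply: integrable_fin_num => //.
    have ii : mu.-integrable `[Num.min x c, Num.max x d] (EFin \o derive1 f).
      by apply: integrableS if' => //; exact: subset_itvcc.
    exact: integrable_norm ii.
  - apply: ge0_subset_integral => //.
      apply/measurable_EFinP/measurableT_comp => //.
      by apply: measurable_funS mf' => //; exact: subset_itvcc.
    exact: subset_itvcc.
have dev u : c <= u -> u <= d -> `|f u - f x| <= B.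
  move=> cu ud; have [xu|ux] := leP x u.
    apply: (le_trans (Hf _ _ ax xu (le_trans ud db))); apply: sub_le.
      by rewrite ge_min lexx.
    by rewrite le_max ud orbT.
  rewrite distrC; apply: (le_trans (Hf _ _ (le_trans ac cu) (ltW ux) xb)); apply: sub_le.
    by rewrite ge_min cu orbT.
  by rewrite le_max lexx.
have icd : mu.-integrable `[c, d] (EFin \o f).
  by apply: integrableS (abs_cont_integrable ab acf) => //; exact: subset_itvcc.
have ifx := integrable_itv_cst c d (f x).
have iB := integrable_itv_cst c d B.
have dc0 : 0 < d - c by rewrite subr_gt0.
have -> : f x = (d - c)^-1 * \int[mu]_(u in `[c, d]) (f x).
  by rewrite Rintegral_itv_cst ?ltW// mulrC mulfK ?gt_eqF.
rewrite -mulrBr -RintegralB// normrM gtr0_norm ?invr_gt0//.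
rewrite ler_pdivrMl//.
have ifB : mu.-integrable `[c, d] (EFin \o (f \- cst (f x))).
  by rewrite (_ : _ \o _ = (EFin \o f) \- (EFin \o cst (f x)))%E//; exact: integrableB.
apply: (le_trans (le_normr_Rintegral _ ifB)) => //.
have -> : (d - c) * B = \int[mu]_(_ in `[c, d]) B.
  by rewrite Rintegral_itv_cst ?(ltW cd)// mulrC.
apply: le_Rintegral => //.
  exact: integrable_norm ifB.
by move=> u /=; rewrite in_itv/= => /andP[cu ud]; exact: dev.
Qed.

(** [(v + 1)^2 <= 4 * (v^2 / 2 + 1 / 2)], and the factor [4 lam / N <= 1] comes
    out of [phi] by convexity. *)
Lemma phi_quadratic phi (lam N h v : R) :
  phi_function phi -> convex_nneg phi ->
  0 <= lam -> 0 < N -> 4 * lam <= N -> 0 <= h -> 0 <= v -> N * h <= v + 1 ->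
  phi (lam * N * h ^+ 2) <= 2 * (lam / N) * (phi (v ^+ 2) + phi 1).
Proof.
move=> Pphi cphi lam0 N0 lamN h0 v0 hv.
have t0 : 0 <= 4 * lam / N by rewrite divr_ge0 ?mulr_ge0// ltW.
have t1 : 4 * lam / N <= 1 by rewrite ler_pdivrMr// mul1r.
have half0 : 0 <= 2^-1 :> R by lra.
have half1 : 2^-1 <= 1 :> R by lra.
pose w := 2^-1 * v ^+ 2 + (1 - 2^-1) * 1.
have v20 := sqr_ge0 v.
have w0 : 0 <= w by rewrite /w; lra.
apply: (@le_trans _ _ (phi (4 * lam / N * w))).
  apply: (phi_ndecr Pphi); first by rewrite !mulr_ge0 ?sqr_ge0// ltW.
  have -> : lam * N * h ^+ 2 = lam / N * (N * h) ^+ 2.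
    by field; rewrite gt_eqF.
  have -> : 4 * lam / N * w = lam / N * (4 * w) by ring.
  apply: ler_wpM2l; first by rewrite divr_ge0// ltW.
  have Nh0 : 0 <= N * h by rewrite mulr_ge0// ltW.
  have : (N * h) ^+ 2 <= (v + 1) ^+ 2.
    by rewrite ler_pXn2r// nnegrE addr_ge0.
  have := sqr_ge0 (v - 1); rewrite /w; lra.
apply: (le_trans (convex_nneg_scale cphi (phi_0 Pphi) t0 t1 w0)).
have -> : 2 * (lam / N) * (phi (v ^+ 2) + phi 1) =
  4 * lam / N * (2^-1 * phi (v ^+ 2) + (1 - 2^-1) * phi 1) by field; rewrite gt_eqF.
by apply: ler_wpM2l => //; exact: convex_nnegP.
Qed.

(** One step of Jensen's inequality, for a supporting line [c0 + s * y] of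
    [phi]: the line is affine, so it commutes with the mean over [[p, q]] and can
    be compared with [phi] inside the integral.  There, with [h = q - p],
    [h g <= max (N h^2) (g^2 / N)]. *)
Lemma affine_jensen phi (c0 s p q lam N : R) (g G : R -> R) :
  phi_function phi -> 0 <= s -> (forall y, 0 <= y -> c0 + s * y <= phi y) ->
  0 <= lam -> 0 < N -> p < q ->
  (forall t, p <= t -> t <= q -> 0 <= g t /\ phi (lam * g t ^+ 2 / N) <= G t) ->
  mu.-integrable `[p, q] (EFin \o g) -> mu.-integrable `[p, q] (EFin \o G) ->
  c0 + s * (lam * \int[mu]_(t in `[p, q]) g t) <=
  phi (lam * N * (q - p) ^+ 2) + (q - p)^-1 * \int[mu]_(t in `[p, q]) G t.
Proof.
move=> Pphi s0 minor lam0 N0 pq gG ig iG.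
set h := q - p; have h0 : 0 < h by rewrite subr_gt0.
have phi_ge0 := phi_ge0 Pphi.
have ptw t : p <= t -> t <= q ->
    c0 + s * lam * h * g t <= phi (lam * N * h ^+ 2) + G t.
  move=> pt tq; have [gt0 Gt] := gG t pt tq.
  have G0 : 0 <= G t.
    apply: le_trans Gt; apply: phi_ge0.
    by rewrite mulr_ge0 ?invr_ge0 ?(ltW N0)// mulr_ge0 ?sqr_ge0.
  have A0 : 0 <= phi (lam * N * h ^+ 2).
    by apply: phi_ge0; rewrite !mulr_ge0 ?sqr_ge0// ltW.
  have -> : s * lam * h * g t = s * (lam * h * g t) by ring.
  apply: (le_trans (minor _ _)); first by rewrite !mulr_ge0// ltW.
  have [gN|Ng] := leP (g t) (N * h).
    apply: ler_wpDr => //; apply: (phi_ndecr Pphi); first by rewrite !mulr_ge0// ltW.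
    have -> : lam * N * h ^+ 2 = lam * h * (N * h) by ring.
    by apply: ler_wpM2l => //; rewrite mulr_ge0// ltW.
  apply: ler_wpDl => //; apply: le_trans Gt; apply: (phi_ndecr Pphi).
    by rewrite !mulr_ge0// ltW.
  rewrite ler_pdivlMr//.
  have -> : lam * h * g t * N = lam * g t * (N * h) by ring.
  have -> : lam * g t ^+ 2 = lam * g t * g t by ring.
  by apply: ler_wpM2l; [rewrite mulr_ge0|exact: ltW].
have i1 : mu.-integrable `[p, q] (EFin \o (fun t => c0 + s * lam * h * g t)).
  rewrite (_ : _ \o _ = (EFin \o cst c0) \+
    (fun t => (s * lam * h)%:E * (EFin \o g) t))%E//.
  by apply: integrableD => //; [exact: integrable_itv_cst|exact: integrableZl].
have i1' : mu.-integrable `[p, q] (EFin \o (fun t => s * lam * h * g t)).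
  rewrite (_ : _ \o _ = (fun t => (s * lam * h)%:E * (EFin \o g) t))%E//.
  exact: integrableZl.
have i2 : mu.-integrable `[p, q] (EFin \o (fun t => phi (lam * N * h ^+ 2) + G t)).
  rewrite (_ : _ \o _ = (EFin \o cst (phi (lam * N * h ^+ 2))%R) \+ (EFin \o G))%E//.
  by apply: integrableD => //; exact: integrable_itv_cst.
have : \int[mu]_(t in `[p, q]) (c0 + s * lam * h * g t) <=
       \int[mu]_(t in `[p, q]) (phi (lam * N * h ^+ 2) + G t).
  apply: le_Rintegral => // t; rewrite /= in_itv/= => /andP[]; exact: ptw.
rewrite RintegralD//; last exact: integrable_itv_cst.
rewrite RintegralZl// RintegralD//; last exact: integrable_itv_cst.
rewrite !Rintegral_itv_cst ?(ltW pq)// -/h.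
set X := \int[mu]_(t in _) g t; set Y := \int[mu]_(t in _) G t => H.
rewrite -(ler_pM2r h0); apply: le_trans (le_trans _ H) _.
  by rewrite le_eqVlt; apply/orP; left; apply/eqP; ring.
rewrite le_eqVlt; apply/orP; left; apply/eqP; field; rewrite gt_eqF//.
Qed.

End core.

(** * Replacing means by a Cauchy kernel *)

Section pointwise.
Context {R : realType}.
Local Notation mu := (@lebesgue_measure R).

(** The Cauchy (Poisson) kernel of width [1 / N], of total mass [pi]. *)
Definition cauchy_kernel (N y : R) : R := N / (1 + N ^+ 2 * y ^+ 2).

Lemma cauchy_kernel_ge0 N y : 0 <= N -> 0 <= cauchy_kernel N y.
Proof.
by move=> N0; rewrite divr_ge0// addr_ge0// mulr_ge0 ?sqr_ge0.
Qed.

Lemma cauchy_kernel_le N y : 0 <= N -> cauchy_kernel N y <= N.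
Proof.
move=> N0; have h : 1 <= 1 + N ^+ 2 * y ^+ 2.
  by rewrite lerDl mulr_ge0 ?sqr_ge0.
rewrite /cauchy_kernel ler_pdivrMr ?(lt_le_trans ltr01)//.
by rewrite ler_peMr.
Qed.

Lemma continuous_cauchy_kernel N : continuous (cauchy_kernel N).
Proof.
move=> t; apply: cvgM; first exact: cvg_cst.
apply: cvgV.
  by rewrite gt_eqF// ltr_pwDl// mulr_ge0 ?sqr_ge0.
apply: cvgD; first exact: cvg_cst.
apply: cvgM; first exact: cvg_cst.
by apply: cvgM; exact: cvg_id.
Qed.

Lemma integrable_cauchy_kernelM a b N x (G : R -> R) : 0 <= N ->
  mu.-integrable `[a, b] (EFin \o G) ->
  mu.-integrable `[a, b] (EFin \o (fun t => cauchy_kernel N (x - t) * G t)).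
Proof.
move=> N0 iG; have iNG : mu.-integrable `[a, b] (fun t => (N%:E * (EFin \o G) t)%E).
  exact: integrableZl.
apply: le_integrable iNG => //.
  apply/measurable_EFinP/measurable_funM.
    apply: measurable_funTS; apply: measurableT_comp; last exact: measurable_funB.
    by apply: continuous_measurable_fun; exact: continuous_cauchy_kernel.
  by apply/measurable_EFinP; exact: measurable_int iG.
move=> t _ /=; rewrite lee_fin [leLHS]normrM [leRHS]normrM; apply: ler_wpM2r => //.
rewrite (ger0_norm N0) ger0_norm; first exact: cauchy_kernel_le.
exact: cauchy_kernel_ge0.
Qed.

Lemma hull_length (N x k : R) : 0 < N ->
  let p := Num.min x (k / N) in let q := Num.max x ((k + 1) / N) in
  [/\ p <= x, x <= q, N^-1 <= q - p & N * (q - p) <= `|N * x - k| + 1].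
Proof.
move=> N0 p q.
have NV : 0 < N^-1 by rewrite invr_gt0.
have cd : (k + 1) / N = k / N + N^-1 by rewrite mulrDl mul1r.
have Nc : N * (k / N) = k by rewrite mulrC divfK ?gt_eqF.
have NN : N * N^-1 = 1 by rewrite divff ?gt_eqF.
have pc : p <= k / N by rewrite /p ge_min lexx orbT.
have qd : (k + 1) / N <= q by rewrite /q le_max lexx orbT.
split.
- by rewrite /p ge_min lexx.
- by rewrite /q le_max lexx.
- rewrite cd in qd; lra.
- have n1 : N * x - k <= `|N * x - k| by exact: ler_norm.
  have n2 : k - N * x <= `|N * x - k| by rewrite distrC ler_norm.
  have n0 : 0 <= `|N * x - k| by [].
  rewrite mulrBr.
  have -> : N * q = Num.max (N * x) (k + 1).
    by rewrite /q maxr_pMr ?(ltW N0)// mulrDl mul1r mulrDr Nc NN.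
  have -> : N * p = Num.min (N * x) k by rewrite /p minr_pMr ?(ltW N0)// Nc.
  by rewrite /Num.max /Num.min; case: ifP => _; case: ifP => _; lra.
Qed.

(** The hull is at least as long as the cell, so its mean is at most [N] times
    the integral; and [N |x - t| <= |N x - k| + 1] on it, whence
    [1 + N^2 (x - t)^2 <= 3 + 2 (N x - k)^2]. *)
Lemma hull_integral_le a b (G : R -> R) (N x k : R) : 0 < N ->
  mu.-integrable `[a, b] (EFin \o G) -> (forall t, a <= t -> t <= b -> 0 <= G t) ->
  a <= x -> x <= b -> a <= k / N -> (k + 1) / N <= b ->
  (Num.max x ((k + 1) / N) - Num.min x (k / N))^-1 *
    \int[mu]_(t in `[Num.min x (k / N), Num.max x ((k + 1) / N)]) G t <=
  (3 + 2 * (N * x - k) ^+ 2) *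
    \int[mu]_(t in `[a, b]) (cauchy_kernel N (x - t) * G t).
Proof.
move=> N0 iG G0 ax xb ac db.
set p := Num.min x (k / N); set q := Num.max x ((k + 1) / N).
have [px xq hN hv] := hull_length x k N0.
rewrite -/p -/q in px xq hN hv.
have ap : a <= p by rewrite /p le_min ax.
have qb : q <= b by rewrite /q ge_max xb.
have NV : 0 < N^-1 by rewrite invr_gt0.
have h0 : 0 < q - p by exact: lt_le_trans hN.
set v := N * x - k.
have iJ : mu.-integrable `[p, q] (EFin \o G).
  by apply: integrableS iG => //; exact: subset_itvcc.
have ikG := integrable_cauchy_kernelM x (ltW N0) iG.
have ikJ : mu.-integrable `[p, q] (EFin \o (fun t => cauchy_kernel N (x - t) * G t)).
  by apply: integrableS ikG => //; exact: subset_itvcc.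
have c0 : 0 <= 3 + 2 * v ^+ 2 by have := sqr_ge0 v; lra.
apply: (@le_trans _ _ (N * \int[mu]_(t in `[p, q]) G t)).
  apply: ler_wpM2r.
    apply: Rintegral_ge0 => t; rewrite /= in_itv/= => /andP[pt tq].
    by rewrite G0// ?(le_trans ap)// (le_trans tq).
  by rewrite -[leRHS]invrK lef_pV2// posrE.
apply: (@le_trans _ _ ((3 + 2 * v ^+ 2) *
    \int[mu]_(t in `[p, q]) (cauchy_kernel N (x - t) * G t))).
  rewrite -!RintegralZl//; apply: le_Rintegral => //.
  - have iN : mu.-integrable `[p, q] (fun t => (N%:E * (EFin \o G) t)%E).
      exact: integrableZl.
    exact: iN.
  - have iN : mu.-integrable `[p, q] (fun t => ((3 + 2 * v ^+ 2)%:E *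
      (EFin \o (fun t => (cauchy_kernel N (x - t) * G t)%R)) t)%E).
      exact: integrableZl.
    exact: iN.
  - move=> t; rewrite /= in_itv/= => /andP[pt tq].
    rewrite mulrA ler_wpM2r ?G0// ?(le_trans ap)// ?(le_trans tq)//.
    rewrite /cauchy_kernel mulrCA -[leLHS]mulr1 ler_wpM2l ?(ltW N0)//.
    rewrite ler_pdivlMr ?mul1r; last first.
      by rewrite ltr_pwDl// mulr_ge0 ?sqr_ge0.
    have Nxt : `|N * (x - t)| <= `|v| + 1.
      apply: le_trans hv; rewrite normrM gtr0_norm// ler_pM2l// ler_norml; lra.
    have : `|N * (x - t)| ^+ 2 <= (`|v| + 1) ^+ 2.
      by rewrite ler_pXn2r// nnegrE addr_ge0.
    rewrite real_normK ?num_real// exprMn => H.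
    have := sqr_ge0 (`|v| - 1); have := real_normK (num_real v).
    rewrite -[v ^+ 2]/(v ^+ 2); nra.
apply: ler_wpM2l => //; apply: fine_le.
- exact: integrable_fin_num.
- exact: integrable_fin_num.
- apply: ge0_subset_integral => //.
  + exact: measurable_int ikG.
  + move=> t; rewrite /= in_itv/= => /andP[pt tq].
    by rewrite lee_fin mulr_ge0 ?cauchy_kernel_ge0 ?(ltW N0)// G0.
  + exact: subset_itvcc.
Qed.

End pointwise.

(** * The pointwise estimate *)

Section Kop_pointwise.
Context {R : realType}.
Local Notation mu := (@lebesgue_measure R).

(** A supporting line of [phi] at the left-hand argument reduces the claim to one
    estimate per index ([piece]).  The weighted sums of [phi (v_k^2)] and of
    [v_k^2] are then at most [M / c0] and [1 + M / (c0 * phi 1)], because the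
    normalizing sum [D] is at least [c0]. *)
Lemma Kop_pointwise a b (sigma phi f G : R -> R) (n : nat) (lam c0 M x : R) :
  a <= b -> sigmoidal sigma -> phi_function phi -> convex_nneg phi ->
  abs_cont a b f -> measurable_fun `[a, b] (derive1 f) ->
  admissible a b n -> 0 <= lam -> 4 * lam <= n%:R ->
  0 < c0 -> (forall v, `|v| <= 2 -> c0 <= density sigma v) ->
  (forall u K, finite_set K ->
     \sum_(k \in K) density sigma (u - k%:~R) * phi ((u - k%:~R) ^+ 2) <= M) ->
  mu.-integrable `[a, b] (EFin \o G) ->
  (forall t, a <= t -> t <= b -> phi (lam * (derive1 f t) ^+ 2 / n%:R) <= G t) ->
  a <= x -> x <= b ->
  phi `|lam * (Kop a b sigma f n x - f x)| <=
  2 * (M / c0 + phi 1) * (lam / n%:R) +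
  (5 + 2 * (M / c0) / phi 1) *
    \int[mu]_(t in `[a, b]) (cauchy_kernel n%:R (x - t) * G t).
Proof.
move=> ab Ps Pphi cphi acf mf' adm lam0 lamn c00 dens_lb momM iG phiG ax xb.
have n0 := admissible_gt0 adm.
set N : R := n%:R in lamn phiG *; have N0 : 0 < N by rewrite ltr0n.
have phi1 : 0 < phi 1 := phi_gt0 Pphi ltr01.
have phi_ge0 := phi_ge0 Pphi.
have G0 t : a <= t -> t <= b -> 0 <= G t.
  move=> at_ tb; apply: le_trans (phiG t at_ tb); apply: phi_ge0.
  by rewrite divr_ge0 ?(ltW N0)// mulr_ge0 ?sqr_ge0.
have finK := finite_Kindex a b n.
pose s : seq int := finmap.enum_fset (fset_set (Kindex a b n)).
have sK k : (k \in s) = (k \in Kindex a b n) by exact: in_fset_set.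
have us : uniq s by exact: finmap.fset_uniq.
pose d k := density sigma (N * x - k%:~R).
have d0 k : 0 <= d k by exact: density_ge0.
pose D := \sum_(k <- s) d k.
have D_ge : c0 <= D.
  have [k Kk kx] := Kindex_near adm ax xb.
  have ks : k \in s by rewrite sK inE.
  rewrite /D (bigD1_seq k)//=; apply: ler_wpDr; first exact: sumr_ge0.
  exact: dens_lb.
have D0 : 0 < D by exact: lt_le_trans D_ge.
pose w k := d k / D.
have w0 k : 0 <= w k by rewrite divr_ge0// ltW.
have w1 : \sum_(k <- s) w k = 1 by rewrite -mulr_suml divff// gt_eqF.
pose v k := N * x - k%:~R.
pose p k := Num.min x (k%:~R / N); pose q k := Num.max x ((k%:~R + 1) / N).
pose B k := \int[mu]_(t in `[p k, q k]) `|derive1 f t|.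
pose cell k := \int[mu]_(u in `[k%:~R / N, (k%:~R + 1) / N]) f u.
pose J := \int[mu]_(t in `[a, b]) (cauchy_kernel N (x - t) * G t).
have J0 : 0 <= J.
  apply: Rintegral_ge0 => t; rewrite /= in_itv/= => /andP[at_ tb].
  by rewrite mulr_ge0 ?cauchy_kernel_ge0 ?G0// ltW.
have cellP k : k \in s ->
    a <= k%:~R / N /\ (k%:~R + 1) / N <= b.
  rewrite sK inE => Kk; have := Kindex_itv n0 Kk.
  by rewrite intrD.
have dev k : k \in s -> `|N * cell k - f x| <= B k.
  move=> /cellP[ak kb].
  have cd : k%:~R / N < (k%:~R + 1) / N by rewrite ltr_pM2r ?invr_gt0// ltrDl.
  have := cell_average_deviation ab acf mf' ak cd kb ax xb.
  have -> : (k%:~R + 1) / N - k%:~R / N = N^-1 by ring.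
  by rewrite invrK.
have KopE : Kop a b sigma f n x - f x = \sum_(k <- s) w k * (N * cell k - f x).
  rewrite /Kop !fsbig_finite//= -/s -/D.
  under [RHS]eq_bigr do rewrite mulrBr.
  rewrite sumrB -mulr_suml w1 mul1r; congr (_ - _).
  rewrite mulr_suml; apply: eq_bigr => k _.
  rewrite /w -/N -/(d k) intrD -[X in N * X * _]/(cell k).
  ring.
set m := `|lam * _|.
have mB : m <= \sum_(k <- s) w k * (lam * B k).
  rewrite /m normrM (ger0_norm lam0) KopE.
  apply: (@le_trans _ _ (lam * \sum_(k <- s) w k * B k)).
    apply: ler_wpM2l => //; apply: (le_trans (ler_norm_sum _ _ _)).
    rewrite big_seq [leRHS]big_seq; apply: ler_sum => k ks.
    by rewrite normrM ger0_norm// ler_wpM2l// dev.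
  by rewrite mulr_sumr; under eq_bigr do rewrite mulrCA.
(* the line [c + sl * y] supports [phi] at [m] *)
have [sl sl0 slP] := convex_nneg_affine_minorant Pphi cphi (normr_ge0 _ : 0 <= m).
pose c := phi m - sl * m.
have minor y : 0 <= y -> c + sl * y <= phi y.
  by move=> y0; apply: le_trans (slP y y0); rewrite /c mulrBr; lra.
have [if' _] := abs_cont_integrable_derive1 ab acf mf'.
have piece k : k \in s -> c + sl * (lam * B k) <=
    2 * (lam / N) * (phi (v k ^+ 2) + phi 1) + (3 + 2 * v k ^+ 2) * J.
  move=> /cellP[ak kb].
  have [px xq hN hv] := hull_length x k%:~R N0.
  rewrite -/(p k) -/(q k) -/(v k) in px xq hN hv.
  have NV : 0 < N^-1 by rewrite invr_gt0.
  have pq : p k < q k by rewrite -subr_gt0 (lt_le_trans NV).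
  have ap : a <= p k by rewrite /p le_min ax.
  have qb : q k <= b by rewrite /q ge_max xb.
  have iJ : mu.-integrable `[p k, q k] (EFin \o G).
    by apply: integrableS iG => //; exact: subset_itvcc.
  have iJf : mu.-integrable `[p k, q k] (EFin \o derive1 f).
    by apply: integrableS if' => //; exact: subset_itvcc.
  have iJn := integrable_norm iJf.
  have gG t : p k <= t -> t <= q k ->
      0 <= `|derive1 f t| /\ phi (lam * `|derive1 f t| ^+ 2 / N) <= G t.
    move=> pt tq; split => //; rewrite real_normK ?num_real//.
    by apply: phiG; [exact: le_trans pt|exact: le_trans qb].
  apply: (le_trans (affine_jensen Pphi sl0 minor lam0 N0 pq gG iJn iJ)).
  apply: lerD.
    have := phi_quadratic Pphi cphi lam0 N0 lamn (h := q k - p k) (v := `|v k|).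
    rewrite real_normK ?num_real//; apply => //.
    by rewrite subr_ge0 ltW.
  exact: hull_integral_le.
have mainle : phi m <= \sum_(k <- s) w k *
   (2 * (lam / N) * (phi (v k ^+ 2) + phi 1) + (3 + 2 * v k ^+ 2) * J).
  apply: (@le_trans _ _ (\sum_(k <- s) w k * (c + sl * (lam * B k)))).
    under eq_bigr do rewrite mulrDr mulrCA.
    rewrite big_split/= -mulr_suml w1 mul1r -mulr_sumr.
    rewrite -[leLHS](subrK (sl * m)) -/c lerD2l.
    exact: ler_wpM2l.
  rewrite big_seq [leRHS]big_seq; apply: ler_sum => k ks.
  by apply: ler_wpM2l => //; exact: piece.
(* weighted moments of [phi (v^2)] and of [v^2] *)
pose P := \sum_(k <- s) w k * phi (v k ^+ 2).
pose Q := \sum_(k <- s) w k * v k ^+ 2.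
have PM : P <= M / c0.
  have PE : P = (\sum_(k <- s) d k * phi (v k ^+ 2)) / D.
    by rewrite /P mulr_suml; apply: eq_bigr => k _; rewrite /w mulrAC.
  have := momM (N * x) _ finK; rewrite fsbig_finite//= -/s => H.
  rewrite PE ler_pdivrMr//; apply: (le_trans H).
  have M0 : 0 <= M.
    by apply: le_trans H; apply: sumr_ge0 => k _; rewrite mulr_ge0 ?phi_ge0 ?sqr_ge0// d0.
  by rewrite mulrAC ler_pdivlMr// ler_wpM2l.
have QP : Q <= 1 + P / phi 1.
  rewrite -(ler_pM2l phi1) mulrDr mulr1 [phi 1 * (P / _)]mulrC divfK ?gt_eqF//.
  apply: (@le_trans _ _ (\sum_(k <- s) w k * (phi 1 + phi (v k ^+ 2)))).
    rewrite /Q mulr_sumr; apply: ler_sum => k _; rewrite mulrCA.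
    by apply: ler_wpM2l => //; exact: sqr_le_phi.
  under eq_bigr do rewrite mulrDr.
  by rewrite big_split/= -mulr_suml w1 mul1r.
have sumE : \sum_(k <- s) w k *
   (2 * (lam / N) * (phi (v k ^+ 2) + phi 1) + (3 + 2 * v k ^+ 2) * J) =
   2 * (lam / N) * (P + phi 1) + (3 + 2 * Q) * J.
  have -> : 2 * (lam / N) * (P + phi 1) + (3 + 2 * Q) * J =
    2 * (lam / N) * P + (2 * (lam / N) * phi 1 + 3 * J) * (\sum_(k <- s) w k) +
    2 * J * Q by rewrite w1; ring.
  rewrite /P /Q !mulr_sumr -!big_split/=; apply: eq_bigr => k _; ring.
apply: (le_trans mainle); rewrite sumE; apply: lerD.
  rewrite -mulrA [leRHS]mulrAC -[leRHS]mulrA; apply: ler_wpM2l => //.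
  by apply: ler_wpM2l; [rewrite divr_ge0// ltW|rewrite lerD2r].
apply: ler_wpM2r => //.
have PV : P / phi 1 <= M / c0 / phi 1 by rewrite ler_pM2r ?invr_gt0.
rewrite -[2 * (M / c0) / phi 1]mulrA; lra.
Qed.

End Kop_pointwise.

(** * Convolution with the Cauchy kernel *)

Section convolution.
Context {R : realType}.
Local Notation mu := (@lebesgue_measure R).

Lemma integral_cauchy_kernel_le (a b N t : R) : a < b -> 0 < N ->
  (\int[mu]_(x in `[a, b]) (cauchy_kernel N (x - t))%:E <= (pi : R)%:E)%E.
Proof.
move=> ab N0; pose F := (atan : R -> R) \o (fun x => N * (x - t)).
have dF (x : R) : is_derive x 1 F (cauchy_kernel N (x - t)).
  have dg : is_derive x 1 (fun x : R => N * (x - t)) N.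
    have -> : (fun x : R => N * (x - t)) = N \*: ((@id R) - cst t) by [].
    by apply: is_derive_eq; rewrite subr0 -[RHS]mulr1.
  have := @is_derive1_comp _ (atan : R -> R) (fun x => N * (x - t)) x _ _
    (is_derive1_atan _) dg.
  by rewrite /cauchy_kernel mulrC exprMn.
have cF : continuous F.
  by move=> x; apply/differentiable_continuous/derivable1_diffP; exact: ex_derive.
rewrite (@continuous_FTC2 _ _ F)//.
- rewrite -EFinB lee_fin /F/=.
  have := atan_ltpi2 (N * (b - t)); have := atan_gtNpi2 (N * (a - t)); lra.
- apply: continuous_subspaceT => x.
  apply: (@continuous_comp _ _ _ (fun x => x - t) (cauchy_kernel N)).
    by apply: cvgB; [exact: cvg_id|exact: cvg_cst].
  exact: continuous_cauchy_kernel.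
- split.
  + by move=> x _; exact: ex_derive.
  + exact/cvg_at_right_filter/cF.
  + exact/cvg_at_left_filter/cF.
- by move=> x _; rewrite derive1E; exact: derive_val.
Qed.

(** Tonelli's theorem, after extending the integrand by zero outside the square
    [[a, b] * [a, b]].  The measurability of the inner integral comes from the
    same theorem and is needed to integrate pointwise bounds. *)
Lemma integral_cauchy_convolution_le (a b N : R) (G : R -> R) :
  a < b -> 0 < N -> measurable_fun `[a, b] G ->
  (forall t, a <= t -> t <= b -> 0 <= G t) ->
  (\int[mu]_(x in `[a, b])
     \int[mu]_(t in `[a, b]) (cauchy_kernel N (x - t) * G t)%:E <=
   (pi : R)%:E * \int[mu]_(t in `[a, b]) (G t)%:E)%E /\
  measurable_fun `[a, b]
    (fun x => \int[mu]_(t in `[a, b]) (cauchy_kernel N (x - t) * G t)%:E)%E.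
Proof.
move=> ab N0 mG G0.
pose I : set R := `[a, b]%classic.
pose Gt : R -> R := G \_ I.
have Gt0 t : 0 <= Gt t.
  rewrite /Gt patchE; case: ifPn => //; rewrite inE /I/= in_itv/= => /andP[].
  exact: G0.
have mI : measurable I by exact: measurable_itv.
have mGt : measurable_fun setT Gt by apply/(measurable_restrictT _ _).1.
pose H (z : measurableTypeR R * measurableTypeR R) :=
  (\1_I z.1 * (cauchy_kernel N (z.1 - z.2) * Gt z.2))%:E.
have H0 z : (0 <= H z)%E.
  rewrite lee_fin; apply: mulr_ge0 => //; apply: mulr_ge0 => //.
  exact/cauchy_kernel_ge0/ltW.
have mH : measurable_fun setT H.
  apply/measurable_EFinP/measurable_funM.
    have m1 : measurable_fun setT (\1_I : R -> R) by exact: measurable_indic.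
    exact: measurableT_comp m1 measurable_fst.
  apply: measurable_funM.
    apply: measurableT_comp; last exact: measurable_funB.
    by apply: continuous_measurable_fun; exact: continuous_cauchy_kernel.
  exact: measurableT_comp.
have HxE x : x \in I -> (\int[mu]_(t in I) (cauchy_kernel N (x - t) * G t)%:E =
    \int[mu]_t H (x, t))%E.
  move=> xI; rewrite integral_mkcond; apply: eq_integral => t _.
  rewrite /H/= indicE xI mul1r patchE /Gt patchE.
  by case: ifPn => //; rewrite mulr0.
have mHF : measurable_fun setT (fun x => \int[mu]_t H (x, t))%E.
  exact: measurable_fun_fubini_tonelli_F mH H0.
split; last first.
  apply: (eq_measurable_fun (fun x => \int[mu]_t H (x, t))%E).
    by move=> x xI; rewrite HxE.
  exact: measurable_funTS mHF.
apply: (@le_trans _ _ (\int[mu]_(x in I) \int[mu]_t H (x, t))%E).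
  rewrite le_eqVlt; apply/orP; left; apply/eqP.
  by apply: eq_integral => x xI; exact: HxE.
apply: (@le_trans _ _ (\int[mu]_x \int[mu]_t H (x, t))%E).
  apply: ge0_subset_integral => //.
  by move=> x _; apply: integral_ge0.
rewrite (fubini_tonelli _ mH H0).
have -> : ((pi : R)%:E * \int[mu]_(t in I) (G t)%:E =
    \int[mu]_t ((pi : R)%:E * (Gt t)%:E))%E.
  rewrite ge0_integralZl//; last 3 first.
  - exact/measurable_EFinP.
  - by move=> t _; rewrite lee_fin.
  - by rewrite lee_fin pi_ge0.
  congr *%E; rewrite [LHS]integral_mkcond; apply: eq_integral => t _.
  by rewrite patchE /Gt patchE; case: ifPn.
apply: ge0_le_integral => //.
- by move=> t _; apply: integral_ge0.
- exact: measurable_fun_fubini_tonelli_G.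
- by apply: measurable_funeM; exact/measurable_EFinP.
move=> t _; rewrite muleC.
apply: (@le_trans _ _ ((Gt t)%:E * \int[mu]_(x in I) (cauchy_kernel N (x - t))%:E)%E).
  rewrite -ge0_integralZl//; last 3 first.
  - apply/measurable_EFinP; apply: measurable_funTS.
    apply: measurableT_comp; last exact: measurable_funB.
    by apply: continuous_measurable_fun; exact: continuous_cauchy_kernel.
  - by move=> x _; rewrite lee_fin cauchy_kernel_ge0// ltW.
  - by rewrite lee_fin.
  rewrite [leRHS]integral_mkcond le_eqVlt; apply/orP; left; apply/eqP.
  apply: eq_integral => x _; rewrite /H/= indicE patchE.
  by case: ifPn => _; rewrite ?mul0r// mul1r mulrC.
by apply: lee_wpmul2l; [rewrite lee_fin|exact: integral_cauchy_kernel_le].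
Qed.

End convolution.

(** * The modular inequality *)

Section measurable_Kop.
Context {R : realType}.

(** The denominator is nonnegative, so its inverse is its real power of exponent
    -1, which is measurable. *)
Lemma measurable_Kop a b (sigma f : R -> R) n : sigmoidal sigma ->
  measurable_fun setT (Kop a b sigma f n).
Proof.
move=> Ps; have finK := finite_Kindex a b n.
pose s : seq int := finmap.enum_fset (fset_set (Kindex a b n)).
have md (k : int) : measurable_fun setT
    (fun x : R => density sigma (n%:R * x - k%:~R)).
  apply: (measurableT_comp (measurable_density Ps)).
  by apply: measurable_funB => //; exact: measurable_funM.
have -> : Kop a b sigma f n = fun x : R =>
  (\sum_(k <- s) (n%:R *
      \int[lebesgue_measure]_(u in `[k%:~R / n%:R, (k + 1)%:~R / n%:R]) f u)
       * density sigma (n%:R * x - k%:~R)) *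
  (\sum_(k <- s) density sigma (n%:R * x - k%:~R)) `^ (-1).
  apply/funext => x; rewrite /Kop !fsbig_finite// powR_inv1//.
  by apply: sumr_ge0 => k _; exact: density_ge0.
apply: measurable_funM.
  by apply: measurable_sum => k; exact: measurable_funM.
have mD : measurable_fun setT
    (fun x : R => \sum_(k <- s) density sigma (n%:R * x - k%:~R)).
  exact: measurable_sum.
exact: measurableT_comp (measurable_powR (-1)) mD.
Qed.

End measurable_Kop.

Theorem theorem4p12 (R : realType) (a b : R) (sigma phi : R -> R) (beta : R)
    (psi : R -> R) (L : R) :
  a < b ->
  sigmoidal sigma ->
  phi_function phi ->
  convex_nneg phi ->
  1 < beta ->
  (forall u v : R, 0 < u -> u <= v -> u `^ (- beta) * phi u <= v `^ (- beta) * phi v) ->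
  (moment phi 0 2 (density sigma) < +oo)%E ->
  1 <= L ->
  phi_function psi ->
  convex_nneg (fun x => psi x `^ beta^-1) ->
  (forall t : R, 0 <= t -> psi (t / L) <= phi t /\ phi t <= psi (L * t)) ->
  exists xi1 xi2 : R, [/\ 0 < xi1, 0 < xi2 &
    forall f : R -> R, sobolev_orlicz2 a b phi f ->
      exists lambda : R, [/\ 0 < lambda, lambda < 1 &
        \forall n \near \oo, admissible a b n ->
          (modular a b phi (fun x => lambda * (Kop a b sigma f n x - f x))%R
           <= (xi1 * (lambda / n%:R))%:E
              + xi2%:E * modular a b phi
                  (fun x => 4 * lambda * L ^+ 2 / n%:R * (derive1 f x) ^+ 2)%R)%E]].
Proof.
move=> ab Ps Pphi cphi _ _ Moo L1 _ _ _.
have [c0 c00 dens_lb] := density_lb Ps.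
have [M M0 momM] := moment_bound Moo.
have phi1 : 0 < phi 1 := phi_gt0 Pphi ltr01.
pose A := 2 * (M / c0 + phi 1); pose B := 5 + 2 * (M / c0) / phi 1.
have Mc0 : 0 <= M / c0 by rewrite divr_ge0// ltW.
have A0 : 0 < A by rewrite mulr_gt0// ltr_wpDl.
have B0 : 0 < B by rewrite ltr_wpDr// divr_ge0 ?(ltW phi1)// mulr_ge0.
exists (A * (b - a)), (B * pi); split.
- by rewrite mulr_gt0 ?subr_gt0.
- by rewrite mulr_gt0 ?pi_gt0.
move=> f [[acf [mf' _]] _]; exists 2^-1; split; [lra|lra|].
near=> n; move=> adm.
have n0 := admissible_gt0 adm.
have N0 : 0 < n%:R :> R by rewrite ltr0n.
have n2 : 4 * 2^-1 <= n%:R :> R.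
  rewrite (_ : 4 * 2^-1 = 2%:R :> R); last by field.
  by rewrite ler_nat; near: n; exact: nbhs_infty_ge.
have lam0 : 0 <= 2^-1 :> R by lra.
set lam : R := 2^-1 in n2 lam0 *.
have lamn0 : 0 <= lam / n%:R by rewrite divr_ge0// ltW.
pose G t := phi `|4 * lam * L ^+ 2 / n%:R * (derive1 f t) ^+ 2|.
have phi_ge0 := phi_ge0 Pphi.
have G0 t : 0 <= G t by exact: phi_ge0.
have mG : measurable_fun `[a, b] G.
  apply: (measurableT_comp (measurable_phi_norm Pphi)).
  by apply: measurable_funM => //; exact: measurable_funX.
have phiG t : a <= t -> t <= b -> phi (lam * (derive1 f t) ^+ 2 / n%:R) <= G t.
  move=> _ _; apply: (phi_ndecr Pphi).
    by rewrite mulr_ge0 ?invr_ge0 ?(ltW N0)// mulr_ge0 ?sqr_ge0.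
  apply: le_trans (ler_norm _); rewrite mulrAC [leRHS]mulrC [leLHS]mulrC.
  apply: ler_wpM2l; first exact: sqr_ge0.
  rewrite ler_pM2r ?invr_gt0//.
  have L2 : 1 <= L ^+ 2 by rewrite expr2; nra.
  nra.
(* an infinite modular on the right leaves nothing to prove; otherwise [G] is
   integrable *)
have [Goo|Gfin] := eqVneq (modular a b phi
    (fun x => 4 * lam * L ^+ 2 / n%:R * derive1 f x ^+ 2)) +oo%E.
  rewrite Goo gt0_muley ?lte_fin ?mulr_gt0 ?pi_gt0//.
  by rewrite addey ?leey.
have iG : lebesgue_measure.-integrable `[a, b] (EFin \o G).
  apply/integrableP; split; first exact/measurable_EFinP.
  rewrite (_ : (\int[_]_(_ in _) _)%E = modular a b phi
    (fun x => 4 * lam * L ^+ 2 / n%:R * derive1 f x ^+ 2)).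
    by rewrite ltey.
  by apply: eq_integral => t _ /=; rewrite ger0_norm.
have [conv mconv] := integral_cauchy_convolution_le ab N0 mG (fun t _ _ => G0 t).
pose I x := \int[lebesgue_measure]_(t in `[a, b]) (cauchy_kernel n%:R (x - t) * G t).
have IE x : (I x)%:E =
    (\int[lebesgue_measure]_(t in `[a, b]) (cauchy_kernel n%:R (x - t) * G t)%:E)%E.
  rewrite fineK//; apply: integrable_fin_num => //.
  exact: (integrable_cauchy_kernelM x (ltW N0) iG).
have I0 x : 0 <= I x.
  apply: Rintegral_ge0 => t _; apply: mulr_ge0 => //.
  exact/cauchy_kernel_ge0/ltW.
have mf : measurable_fun `[a, b] f.
  by apply/measurable_EFinP; exact: measurable_int (abs_cont_integrable (ltW ab) acf).
have mI : measurable_fun `[a, b] (fun x => (I x)%:E).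
  by apply: eq_measurable_fun mconv => x _; rewrite IE.
apply: (@le_trans _ _ (\int[lebesgue_measure]_(x in `[a, b])
    ((A * (lam / n%:R))%:E + B%:E * (I x)%:E))%E).
  apply: ge0_le_integral => //.
  - by move=> x _; rewrite lee_fin phi_ge0.
  - apply/measurable_EFinP/(measurableT_comp (measurable_phi_norm Pphi)).
    apply: measurable_funM => //; apply: measurable_funB => //.
    by apply: measurable_funTS; exact: measurable_Kop.
  - by apply: emeasurable_funD => //; exact: measurable_funeM.
  - move=> x; rewrite /= in_itv/= => /andP[ax xb]; rewrite -EFinM -EFinD lee_fin.
    exact: (Kop_pointwise (ltW ab) Ps Pphi cphi acf mf' adm lam0 n2 c00
      dens_lb momM iG phiG ax xb).
rewrite ge0_integralD//; last 3 first.
- by move=> x _; rewrite lee_fin mulr_ge0// ltW.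
- by move=> x _; rewrite mule_ge0// lee_fin// ltW.
- exact: measurable_funeM.
rewrite integral_cst//= lebesgue_measure_itv/= lte_fin ab -EFinB -EFinM.
rewrite ge0_integralZl//; last 2 first.
- by move=> x _; rewrite lee_fin.
- by rewrite lee_fin ltW.
apply: leeD; first by rewrite lee_fin mulrAC.
rewrite EFinM -muleA; apply: lee_wpmul2l; first by rewrite lee_fin ltW.
by under eq_integral do rewrite IE.
Unshelve. all: by end_near. Qed.
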